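(* Let $\mathbb X=(X,\tau,\mathsf d,\mathfrak m)$ and $\mathbb X'=(X',\tau',\mathsf d',\mathfrak m')$ be two extended metric-topological measure spaces and let $\iota:X\to X'$ be a measure-preserving embedding of $\mathbb X$ into $\mathbb X'$. Then $\iota^*$ is an isomorphism of $H^{1,p}(\mathbb X')$ onto $H^{1,p}(\mathbb X)$ and $$\text{for every }f=\iota^*f'\in H^{1,p}(\mathbb X):\qquad |\mathrm Df|_\star=\iota^*\big(|\mathrm Df'|_\star\big).$$
   Context: $p\in(1,\infty)$ is fixed. An extended distance on $X$ is a symmetric map $\mathsf d:X\times X\to[0,\infty]$ satisfying the triangle inequality, with $\mathsf d(x,y)=0$ iff $x=y$. For $f:X\to\mathbb R$ and $A\subset X$, $\mathrm{Lip}(f,A,\mathsf d)=\inf\{L\in[0,\infty]:|f(y)-f(z)|\le L\,\mathsf d(y,z)\ \forall y,z\in A\}$. For a Hausdorff space $(X,\tau)$, $C_b(X)$ is the space of bounded $\tau$-continuous real functions, $\mathrm{Lip}_b(X,\tau,\mathsf d)=\{f\in C_b(X):\mathrm{Lip}(f,X,\mathsf d)<\infty\}$, and $\mathrm{Lip}_{b,1}(X,\tau,\mathsf d)$ is its subset of functions with $\mathrm{Lip}(f,X,\mathsf d)\le1$. $(X,\tau,\mathsf d)$ is an extended metric-topological (e.m.t.) space if $\tau$ is the initial topology generated by $\mathrm{Lip}_b(X,\tau,\mathsf d)$ and $\mathsf d(x,y)=\sup_{f\in\mathrm{Lip}_{b,1}(X,\tau,\mathsf d)}|f(x)-f(y)|$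 for all $x,y\in X$. An extended metric-topological measure (e.m.t.m.) space is $\mathbb X=(X,\tau,\mathsf d,\mathfrak m)$ with $(X,\tau,\mathsf d)$ an e.m.t. space and $\mathfrak m$ a finite nonnegative Radon measure on $(X,\tau)$ (a Borel measure with $\mathfrak m(B)=\sup\{\mathfrak m(K):K\subset B\text{ compact}\}$). For $f\in\mathrm{Lip}_b(X,\tau,\mathsf d)$, $\mathrm{lip}f(x)=\inf\{\mathrm{Lip}(f,U,\mathsf d):U\text{ a }\tau\text{-neighborhood of }x\}$. For $f\in L^p(X,\mathfrak m)$, $\mathsf{CE}_{p}(f)=\inf\{\liminf_n\int_X(\mathrm{lip}f_n)^p\,d\mathfrak m:f_n\in\mathrm{Lip}_b(X,\tau,\mathsf d),\ f_n\to f\text{ in }L^p\}$, $H^{1,p}(\mathbb X)=\{f\in L^p(X,\mathfrak m):\mathsf{CE}_p(f)<\infty\}$ with norm $(\mathsf{CE}_p(f)+\|f\|_{L^p}^p)^{1/p}$. $G\in L^p$ is a relaxed gradient of $f\in L^p$ if there are $f_n\in\mathrm{Lip}_b(X,\tau,\mathsf d)$ with $f_n\to f$ in $L^p$, $\mathrm{lip}f_n\rightharpoonup\tilde G$ weakly in $L^p$ and $\tilde G\le G$ a.e.; $|\mathrm Df|_\star$ is the unique relaxed gradient of minimal $L^p$ norm. A map $\iota:X\to X'$ is a measure-preserving embedding of $\mathbb X$ into $\mathbb X'$ if: $\iota$ is continuous and injective from $(X,\tau)$ to $(X',\tau')$; $\mathsf d'(\iota(x),\iota(y))=\mathsf d(x,y)$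 for all $x,y\in X$; $\iota_\sharp\mathfrak m=\mathfrak m'$. For $f':X'\to\mathbb R$, $\iota^*f'=f'\circ\iota$; $\iota^*$ passes to a.e.-equivalence classes and induces a linear isometric isomorphism of $L^p(X',\mathfrak m')$ onto $L^p(X,\mathfrak m)$. *)

(* Defs.v *)
From mathcomp Require Import all_boot all_order all_algebra.
From mathcomp Require Import all_classical all_reals all_analysis.

Set Implicit Arguments.
Unset Strict Implicit.
Unset Printing Implicit Defensive.

Import Order.TTheory GRing.Theory Num.Theory.
Import numFieldNormedType.Exports.

Local Open Scope classical_set_scope.
Local Open Scope ring_scope.
Local Open Scope ereal_scope.

Section extended_metric_topological.
Context {R : realType}.

Record is_extended_distance (X : Type) (d : X -> X -> \bar R) : Prop := {
  edist_ge0 : forall x y, 0 <= d x y ;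
  edist_eq0 : forall x y, d x y = 0 <-> x = y ;
  edist_sym : forall x y, d x y = d y x ;
  edist_triangle : forall x y z, d x z <= d x y + d y z }.

(* The library's convention [0 * +oo = 0] is harmless here: it can only affect
   whether [L = 0] or [L = +oo] is admissible, never the infimum. *)
Definition Lip (X : Type) (d : X -> X -> \bar R) (f : X -> R) (A : set X) :
    \bar R :=
  ereal_inf [set L | 0 <= L /\
    forall y z, A y -> A z -> `|f y - f z|%:E <= L * d y z].

Definition Lip_b (X : topologicalType) (d : X -> X -> \bar R) : set (X -> R) :=
  [set f | [/\ continuous f, bounded_fun f & Lip d f setT < +oo]].

Definition Lip_b1 (X : topologicalType) (d : X -> X -> \bar R) : set (X -> R) :=
  [set f | Lip_b d f /\ Lip d f setT <= 1].

(* The coarsest topology on [X] making every function of [F] continuous. *)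
Definition initial_topology_of (X : choiceType) (F : set (X -> R)) :
    topologicalType :=
  sup_topology (fun f : {f : X -> R | F f} =>
    Topological.on (initial_topology (sval f))).

Record is_emt_space (X : topologicalType) (d : X -> X -> \bar R) : Prop := {
  emt_hausdorff : hausdorff_space X ;
  emt_edist : is_extended_distance d ;
  emt_topology : forall U : set X,
    @open X U <-> @open (initial_topology_of (Lip_b d)) U ;
  emt_dist_sup : forall x y,
    d x y = ereal_sup [set `|f x - f y|%:E | f in Lip_b1 d] }.

Definition borel (X : ptopologicalType) := g_sigma_algebraType (@open X).

Definition is_radon (X : ptopologicalType)
    (m : {measure set (borel X) -> \bar R}) : Prop :=
  forall B : set (borel X), measurable B ->
    m B = ereal_sup [set m K | K in [set K : set X | compact K /\ K `<=` B]].

End extended_metric_topological.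

(* The library's measurable types are pointed, hence the nonempty carrier. *)
Record emtmSpace (R : realType) := EmtmSpace {
  emtm_carrier :> ptopologicalType ;
  emdist : emtm_carrier -> emtm_carrier -> \bar R ;
  emeas : {finite_measure set (borel emtm_carrier) -> \bar R} ;
  emtm_emt : is_emt_space emdist ;
  emtm_radon : is_radon emeas }.

Lemma gt1_EFin_ge1 (R : realType) (p : R) : (1 < p)%R -> 1 <= p%:E.
Proof. by move=> p1; rewrite lee_fin ltW. Qed.

Section sobolev.
Context {R : realType} (X : emtmSpace R) (p : R) (p1 : (1 < p)%R).

Local Notation d := (@emdist R X).
Local Notation m := (@emeas R X).

(* Elements of [L^p] are represented by Borel functions; two such functions
   are the same element when they are equal [m]-almost everywhere. *)
Definition Lpfun := LfunType m (gt1_EFin_ge1 p1).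

Definition lip (f : X -> R) (x : X) : \bar R :=
  ereal_inf [set Lip d f U | U in nbhs x].

Definition cvg_Lp (u : nat -> X -> R) (f : X -> R) : Prop :=
  'N[m]_(p%:E)[EFin \o (u n \- f)%R] @[n --> \oo] --> 0.

Definition CE (f : X -> R) : \bar R :=
  ereal_inf [set limn_einf (fun n => \int[m]_x (lip (u n) x `^ p)) |
    u in [set u : nat -> X -> R | (forall n, Lip_b d (u n)) /\ cvg_Lp u f]].

Definition H1p : set (X -> R) :=
  [set f | f \in Lfun m p%:E /\ CE f < +oo].

Definition H1p_norm (f : X -> R) : \bar R :=
  (CE f + 'N[m]_(p%:E)[EFin \o f] `^ p) `^ p^-1.

Definition weak_cvg_Lp (g : nat -> Lpfun) (G : Lpfun) : Prop :=
  forall phi : {scalar Lpfun},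
    (exists C : R, forall h : Lpfun,
      `|phi h|%:E <= C%:E * 'N[m]_(p%:E)[EFin \o h]) ->
    phi (g n) @[n --> \oo] --> phi G.

Definition relaxed_gradient (f : X -> R) (G : Lpfun) : Prop :=
  exists (u : nat -> X -> R) (g : nat -> Lpfun) (H : Lpfun),
    [/\ forall n, Lip_b d (u n),
        cvg_Lp u f,
        forall n x, (g n x)%:E = lip (u n) x,
        weak_cvg_Lp g H
      & {ae m, forall x, (H x <= G x)%R}].

Definition minimal_relaxed_gradient (f : X -> R) : set Lpfun :=
  [set G | relaxed_gradient f G /\
    forall G', relaxed_gradient f G' ->
      'N[m]_(p%:E)[EFin \o G] <= 'N[m]_(p%:E)[EFin \o G']].

(* For [f] in [H1p] there is, up to a.e. equality, exactly one minimal relaxed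
   gradient; [0] is a dummy value for the other [f]. *)
Definition Dstar (f : X -> R) : Lpfun :=
  xget (0%R : Lpfun) (minimal_relaxed_gradient f).

End sobolev.

Section embedding.
Context {R : realType} (X X' : emtmSpace R).

Record measure_preserving_embedding (iota : X -> X') : Prop := {
  mpe_continuous : continuous iota ;
  mpe_injective : injective iota ;
  mpe_isometry : forall x y, emdist (iota x) (iota y) = emdist x y ;
  mpe_pushforward : forall B : set (borel X'), measurable B ->
    pushforward (@emeas R X) (iota : borel X -> borel X') B = @emeas R X' B }.

Definition pullback (Y : Type) (iota : X -> X') (f' : X' -> Y) : X -> Y :=
  f' \o iota.

(* [T] passes to the quotients by a.e. equality and induces there a linear
   isometric bijection from [H1p X'] onto [H1p X]. *)
Record is_H1p_isomorphism (p : R) (T : (X' -> R) -> X -> R) : Prop := {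
  iso_H1p : forall f', H1p p f' -> H1p p (T f') ;
  iso_ae : forall f' g', H1p p f' -> H1p p g' ->
    f' = g' %[ae @emeas R X'] -> T f' = T g' %[ae @emeas R X] ;
  iso_linear : forall (a : R) f' g', H1p p f' -> H1p p g' ->
    T (fun x => a * f' x + g' x)%R =
      (fun x => a * T f' x + T g' x)%R %[ae @emeas R X] ;
  iso_norm : forall f', H1p p f' -> H1p_norm p (T f') = H1p_norm p f' ;
  iso_injective : forall f' g', H1p p f' -> H1p p g' ->
    T f' = T g' %[ae @emeas R X] -> f' = g' %[ae @emeas R X'] ;
  iso_surjective : forall f, H1p p f ->
    exists2 f', H1p p f' & T f' = f %[ae @emeas R X] }.

End embedding.

(* Main.v *)
Require Import Defs.
From HB Require Import structures.
From mathcomp Require Import all_boot all_order all_algebra.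
From mathcomp Require Import all_classical all_reals all_analysis.
From mathcomp Require Import measurable_realfun.
From mathcomp Require Import ring lra.

Set Implicit Arguments.
Unset Strict Implicit.
Unset Printing Implicit Defensive.
Import Order.TTheory GRing.Theory Num.Theory.
Import numFieldNormedType.Exports.
Local Open Scope classical_set_scope.
Local Open Scope ring_scope.

(** Composition with [iota] maps [Lip_b X'] into [Lip_b X] and does not increase
    [lip], because neighbourhoods of [iota x] pull back to neighbourhoods of
    [x]. Since [iota] preserves the measure, [CE (f' \o iota) <= CE f'] follows
    at once. The content of the theorem is the converse: a function [f] of
    [Lip_b X] must be approximated by functions on [X'], whose topology is
    coarser on the image of [X], without increasing the energy.

    This is possible because the measure is Radon. Cut almost all of [X] into
    finitely many disjoint compact pieces such that on each piece [f] is
    Lipschitz with a constant [a] that exceeds [lip f] by at most [eps] on that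
    piece ([tame_exhaustion]). On compact sets the two topologies agree, and the
    distance of [X'], being a supremum of continuous semidistances, can be
    replaced by one of them, say [D], up to a small error in the Lipschitz
    estimates ([compact_label_lipschitz]). Extend [f] from each piece to a
    [D]-neighbourhood of the piece by McShane's formula with the constant [a].
    Disjoint compact pieces are at positive distance, so the functions obtained
    glue to an [(L + 1)]-Lipschitz function, where [L] is the Lipschitz constant
    of [f]; a second McShane extension, from the union of the neighbourhoods to
    [X'], makes it global ([tame_extension]). The result is continuous because
    [D] is, it is close to [f] on the pieces, its asymptotic Lipschitz constant
    is at most [a] at the points of a piece, and the rest of the space has small
    measure and only contributes bounded quantities ([Lip_b_energy_extension]).
    Hence [CE_pullback], and with it the isometry of the Sobolev norms;
    surjectivity holds because [iota] restricted to a compact set is a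
    homeomorphism onto its image, so that Borel functions can be transported
    ([Lfun_pullback_surjective]).

    For the minimal relaxed gradients it is convenient to pass from weak to
    strong limits. Mazur's lemma ([mazur], by a Hahn-Banach argument) turns a
    relaxed gradient into a strong limit of majorants of slopes, a
    [strong_gradient]. The set of strong gradients of [f] is convex, and the
    [p]-th power of the norm of each of its elements is at least [CE f]; uniform
    convexity of [L^p] ([nrm_uniformly_convex]) and completeness ([Lp_complete])
    then provide an element with equality, which is a relaxed gradient, and show
    that this element is unique ([relaxed_gradient_exists],
    [strong_gradient_unique]). Therefore [Dstar f] is characterized as the
    strong gradient whose norm to the power [p] is [CE f]
    ([minimal_relaxed_gradientP]). Strong gradients pull back under [iota], and
    both the norm and [CE] are preserved, so [Dstar f' \o iota] has the property
    that characterizes [Dstar f]. *)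

(** * Sublinear functionals, Hahn-Banach and Mazur *)

Section hahn_banach.
Context {R : realType} (V : lmodType R).
Implicit Types (q s : V -> R) (K : set (V * R)).

Definition sublinear q :=
  (forall x y, q (x + y) <= q x + q y) /\
  (forall (a : R) x, 0 < a -> q (a *: x) <= a * q x).

Lemma sublinear0 q : sublinear q -> q 0 = 0.
Proof.
move=> [_ qZ]; have := qZ 2 0 ltac:(lra); have := qZ 2^-1 0 ltac:(lra).
by rewrite !scaler0; lra.
Qed.

Lemma sublinearZ q (a : R) x : sublinear q -> 0 <= a -> q (a *: x) = a * q x.
Proof.
move=> sq; rewrite le_eqVlt => /predU1P[<-|a0].
  by rewrite scale0r mul0r sublinear0.
apply/eqP; rewrite eq_le (sq.2 _ _ a0) /=.
have := sq.2 a^-1 (a *: x); rewrite invr_gt0 scalerA mulVf ?gt_eqF// scale1r.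
by move=> /(_ a0); rewrite ler_pdivlMl.
Qed.

Lemma sublinear_oppr q x : sublinear q -> - q (- x) <= q x.
Proof. by move=> sq; have := sq.1 x (- x); rewrite subrr sublinear0//; lra. Qed.

(** Every competitor in the Zorn argument below, and the separating functional
    of Mazur's lemma, is obtained by shifting a sublinear functional along a
    convex cone [K] in the product of [V] and the real line. *)
Definition cone_inf q K (v : V) : R :=
  inf [set q (v + k.1) - k.2 | k in K].

Definition convex_cone K := [/\ K (0, 0),
  forall k l, K k -> K l -> K (k.1 + l.1, k.2 + l.2) &
  forall (a : R) k, 0 < a -> K k -> K (a *: k.1, a * k.2)].

Lemma cone_inf_le q K v k : sublinear q -> (forall k, K k -> k.2 <= q k.1) ->
  K k -> cone_inf q K v <= q (v + k.1) - k.2.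
Proof.
move=> sq Kq Kk; apply: ge_inf; last by exists k.
exists (- q (- v)) => _ [l Kl <-]; have := Kq _ Kl.
by have := sq.1 (v + l.1) (- v); rewrite addrAC subrr add0r; lra.
Qed.

Lemma le_cone_inf q K v r : K !=set0 ->
  (forall k, K k -> r <= q (v + k.1) - k.2) -> r <= cone_inf q K v.
Proof.
move=> [k Kk] h; apply: lb_le_inf; first by exists (q (v + k.1) - k.2), k.
by move=> _ [l Kl <-]; exact: h.
Qed.

Lemma cone_inf_sublinear q K : sublinear q -> convex_cone K ->
  (forall k, K k -> k.2 <= q k.1) -> sublinear (cone_inf q K).
Proof.
move=> sq [K0 KD KZ] Kq; have KN0 : K !=set0 by exists (0, 0).
split=> [x y|a x a0].
  rewrite -lerBlDl; apply: le_cone_inf => // k Kk.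
  rewrite lerBlDl -lerBlDr; apply: le_cone_inf => // l Kl.
  have := cone_inf_le (x + y) sq Kq (KD _ _ Kk Kl) => /=.
  by have := sq.1 (x + l.1) (y + k.1); rewrite [k.1 + _]addrC addrACA; lra.
rewrite -ler_pdivrMl//; apply: le_cone_inf => // k Kk.
rewrite ler_pdivrMl//; apply: le_trans (cone_inf_le _ sq Kq (KZ _ _ a0 Kk)) _.
by rewrite /= -scalerDr mulrBr lerD2r; exact: sq.2.
Qed.

Lemma le_cone_inf_self q K v : sublinear q -> convex_cone K ->
  (forall k, K k -> k.2 <= q k.1) -> cone_inf q K v <= q v.
Proof.
move=> sq [K0 _ _] Kq.
by apply: le_trans (cone_inf_le v sq Kq K0) _; rewrite /= addr0 subr0.
Qed.

Lemma minimal_sublinear_additive q : sublinear q ->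
  (forall s, sublinear s -> (forall x, s x <= q x) -> s = q) ->
  {morph q : x y / x + y}.
Proof.
move=> sq qmin x y; apply/eqP; rewrite eq_le sq.1 /=.
pose K := [set (t *: y, t * q y) | t in [set t : R | 0 <= t]].
have cK : convex_cone K.
  split.
  - by exists 0 => //=; rewrite scale0r mul0r.
  - move=> _ _ [t /= t0 <-] [u /= u0 <-]; exists (t + u); first exact: addr_ge0.
    by rewrite /= scalerDl mulrDl.
  - move=> a _ a0 [t /= t0 <-]; exists (a * t);
      first by rewrite /= mulr_ge0// ltW.
    by rewrite /= scalerA mulrA.
have Kq k : K k -> k.2 <= q k.1 by move=> [t t0 <-]/=; rewrite sublinearZ.
have <- : cone_inf q K = q.
  by apply: qmin => [|v]; [exact: cone_inf_sublinear|exact: le_cone_inf_self].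
have Ky : K (y, q y) by exists 1 => /=; rewrite ?scale1r ?mul1r.
have := cone_inf_le x sq Kq Ky => /=.
have := le_cone_inf_self y sq cK Kq.
have := le_cone_inf_self (x + y) sq cK Kq.
suff -> : cone_inf q K (x + y) = q (x + y) by lra.
by congr (_ _); apply: qmin => [|v];
  [exact: cone_inf_sublinear|exact: le_cone_inf_self].
Qed.

(** Hahn-Banach without any extension step: a minimal sublinear functional below
    [q] is already linear, since shifting it along any direction yields a
    sublinear functional below it. *)
Lemma linear_below_sublinear q : sublinear q ->
  exists phi : {scalar V}, forall x, phi x <= q x.
Proof.
move=> sq.
pose T := {s : V -> R | sublinear s /\ forall x, s x <= q x}.
pose mkT s (h : sublinear s /\ forall x, s x <= q x) : T := exist _ s h.
pose below (s t : T) := `[< forall x, sval t x <= sval s x >].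
have [| | | |m mmin] := @Zorn T below.
- by move=> s; exact/asboolP.
- move=> r s t /asboolP rs /asboolP st; apply/asboolP => x.
  exact: le_trans (st x) (rs x).
- move=> [s sP] [t tP] /asboolP/= st /asboolP/= ts; apply: eq_sig_hprop => /=.
    by move=> ?; exact: Prop_irrelevance.
  by apply/funext => x; apply/eqP; rewrite eq_le st ts.
- move=> A Atot; have [[a Aa]|A0] := pselect (A !=set0); last first.
    have qT : sublinear q /\ forall x, q x <= q x by [].
    by exists (mkT q qT) => s As; case: A0; exists s.
  pose S x := [set sval s x | s in A].
  have Sne x : S x !=set0 by exists (sval a x), a.
  have Slb x : has_lbound (S x).
    exists (- q (- x)) => _ [s As <-]; case: (svalP s) => ss sle.
    by apply: le_trans (sublinear_oppr x ss); rewrite lerN2.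
  have inf_le (s : T) x : A s -> inf (S x) <= sval s x.
    by move=> As; apply: ge_inf => //; exists s.
  have infP : sublinear (fun x => inf (S x)) /\ forall x, inf (S x) <= q x.
    split; last by move=> x; apply: le_trans (inf_le a x Aa) _; case: (svalP a).
    split=> [x y|r x r0].
      rewrite -lerBlDl; apply: lb_le_inf => // _ [s As <-].
      rewrite lerBlDl -lerBlDr; apply: lb_le_inf => // _ [t At <-].
      rewrite lerBlDr; case: (Atot _ _ As At) => /asboolP st.
        apply: le_trans (inf_le t _ At) _; case: (svalP t) => [[tD _] _].
        by apply: le_trans (tD _ _) _; rewrite lerD2l st.
      apply: le_trans (inf_le s _ As) _; case: (svalP s) => [[sD _] _].
      by apply: le_trans (sD _ _) _; rewrite lerD2r st.
    rewrite -ler_pdivrMl//; apply: lb_le_inf => // _ [s As <-].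
    rewrite ler_pdivrMl//; apply: le_trans (inf_le s _ As) _.
    by case: (svalP s) => [[_ sZ] _]; exact: sZ.
  exists (mkT _ infP) => s As; apply/asboolP => x; exact: inf_le.
case: m mmin => m [sm mq] mmin.
have mD : {morph m : x y / x + y}.
  apply: minimal_sublinear_additive => // s ss sm'.
  have sP : sublinear s /\ forall x, s x <= q x.
    by split=> // x; exact: le_trans (mq x).
  by have /(congr1 sval) := mmin (mkT s sP) (introT (asboolP _) sm').
have mN x : m (- x) = - m x.
  by apply/eqP; rewrite -addr_eq0 -mD addNr sublinear0.
have mZ (a : R) x : m (a *: x) = a * m x.
  have [a0|a0] := leP 0 a; first exact: sublinearZ.
  rewrite -[a]opprK scaleNr mN sublinearZ ?mulNr// oppr_ge0; exact: ltW.
have mlin : linear_for *%R m by move=> a x y; rewrite mD mZ.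
pose phi : {scalar V} := HB.pack m (GRing.isLinear.Build R V R *%R m mlin).
by exists phi.
Qed.

(** Mazur's lemma for a seminorm: separating [H] from a convex set at positive
    distance contradicts weak convergence. *)
Lemma mazur q (C : set V) (g : nat -> V) (H : V) : sublinear q ->
  (forall x, q (- x) = q x) ->
  (forall c c' (t : R), 0 <= t <= 1 -> C c -> C c' ->
    C (t *: c + (1 - t) *: c')) ->
  (forall n, C (g n)) ->
  (forall phi : {scalar V}, (forall x, `|phi x| <= q x) ->
    phi (g n) @[n --> \oo] --> phi H) ->
  forall e : R, 0 < e -> exists2 c, C c & q (H - c) < e.
Proof.
move=> sq qN Cconv Cg gH e e0; apply: contrapT => nc.
have far c : C c -> e <= q (H - c).
  by move=> Cc; rewrite leNgt; apply/negP => lt; apply: nc; exists c.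
(* The weight [t * e] makes the functional at most [- e] in the directions
   [c - H]. *)
pose K : set (V * R) :=
  [set k | exists t c, [/\ 0 <= t, C c & k = (t *: (H - c), t * e)]].
have cK : convex_cone K.
  split.
  - by exists 0, (g 0%N); split=> //; rewrite scale0r mul0r.
  - move=> _ _ [t [c [t0 Cc ->]]] [u [c' [u0 Cc' ->]]] /=.
    have := t0; rewrite le_eqVlt => /predU1P[<-|tp].
      by rewrite scale0r mul0r !add0r; exists u, c'.
    have tu : 0 < t + u by rewrite ltr_wpDr.
    exists (t + u), ((t / (t + u)) *: c + (1 - t / (t + u)) *: c'); split.
    - exact: ltW.
    - apply: Cconv => //; rewrite divr_ge0 ?(ltW tu)//=.
      by rewrite ler_pdivrMr// mul1r lerDl.
    - rewrite mulrDl; congr (_, _).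
      have -> : 1 - t / (t + u) = u / (t + u) by field; rewrite gt_eqF.
      rewrite !scalerBr scalerDl scalerDr !scalerA.
      have E (x : R) : (t + u) * (x / (t + u)) = x by field; rewrite gt_eqF.
      by rewrite !E opprD addrACA.
  - move=> a _ a0 [t [c [t0 Cc ->]]] /=; exists (a * t), c.
    by rewrite scalerA mulrA mulr_ge0 ?(ltW a0).
have Kq k : K k -> k.2 <= q k.1.
  move=> [t [c [t0 Cc ->]]] /=.
  by rewrite sublinearZ//; exact/ler_wpM2l/far.
have [phi phiP] := linear_below_sublinear (cone_inf_sublinear sq cK Kq).
have phiq x : phi x <= q x := le_trans (phiP x) (le_cone_inf_self x sq cK Kq).
have phib x : `|phi x| <= q x.
  by have := phiq (- x); rewrite linearN qN ler_norml phiq andbT lerNl.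
have gap c : C c -> phi c <= phi H - e.
  move=> Cc; have Kc : K (H - c, e).
    by exists 1, c; rewrite scale1r mul1r.
  have := le_trans (phiP (- (H - c))) (cone_inf_le _ sq Kq Kc).
  by rewrite /= addNr sublinear0// linearN linearB; lra.
have : phi H <= phi H - e.
  by apply: (ler_cvg_to (gH phi phib) (cvg_cst _)); apply: nearW => n;
    exact: gap.
by move: e0; lra.
Qed.

End hahn_banach.

(** * Uniform convexity of the power function *)

Section power_inequalities.
Context {R : realType} (p : R) (p1 : 1 < p).
Local Notation D a b := ((a `^ p + b `^ p) / 2 - ((a + b) / 2) `^ p).

Let p0 : 0 < p. Proof. exact: lt_trans p1. Qed.

(** Young's inequality, read as the tangent line inequality of the convex
    function [powR ^~ p] at [s]. *)
Lemma powR_tangent (x s : R) : 0 <= x -> 0 <= s ->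
  s `^ p + p * s `^ (p - 1) * (x - s) <= x `^ p.
Proof.
move=> x0 s0; pose q := p / (p - 1).
have pm : 0 < p - 1 by rewrite subr_gt0.
have q0 : 0 < q by rewrite divr_gt0.
have pq : p^-1 + q^-1 = 1 by rewrite /q; field; rewrite ?gt_eqF.
have := conjugate_powR x0 (powR_ge0 s (p - 1)) p0 q0 pq.
rewrite -powRrM; have -> : (p - 1) * q = p by rewrite /q; field; rewrite gt_eqF.
have -> : s `^ p / q = s `^ p - s `^ p / p.
  by rewrite /q; field; rewrite ?gt_eqF.
have := mulr_powRB1 s0 p0.
rewrite -(ler_pM2l p0) !mulrDr mulrN [p * (x `^ p / p)]mulrC divfK ?gt_eqF//.
rewrite [p * (s `^ p / p)]mulrC divfK ?gt_eqF// => <-; lra.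
Qed.

Lemma powR_lipschitz (M x y : R) : 0 <= x <= M -> 0 <= y <= M ->
  `|x `^ p - y `^ p| <= p * M `^ (p - 1) * `|x - y|.
Proof.
move=> xM yM; wlog yx : x y xM yM / y <= x.
  move=> W; have [|/ltW] := leP y x; first exact: W.
  by rewrite distrC (distrC x); exact: W.
have [/andP[x0 xM'] /andP[y0 _]] := (xM, yM).
have pm : 0 <= p - 1 by rewrite subr_ge0 ltW.
rewrite !ger0_norm ?subr_ge0//; last by rewrite ge0_ler_powR// ltW.
apply: (@le_trans _ _ (p * x `^ (p - 1) * (x - y))).
  by have := powR_tangent y0 x0; lra.
rewrite ler_wpM2r ?subr_ge0// ler_wpM2l ?(ltW p0)//.
by rewrite ge0_ler_powR// nnegrE (le_trans x0).
Qed.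

Lemma cvg_powR (u : nat -> R) (l : R) : (forall n, 0 <= u n) ->
  u n @[n --> \oo] --> l -> u n `^ p @[n --> \oo] --> l `^ p.
Proof.
move=> u0 ul.
have l0 : 0 <= l by apply: (ler_cvg_to (cvg_cst _) ul); exact: nearW.
pose M := l + 1.
have K0 : 0 < p * M `^ (p - 1) by rewrite mulr_gt0// powR_gt0// /M; lra.
apply/cvgrPdist_le => e e0; near=> n.
have uM : u n <= M.
  have : `|l - u n| <= 1 by near: n; move/cvgrPdist_le : ul; apply.
  by rewrite ler_norml /M; lra.
have ue : `|l - u n| <= e / (p * M `^ (p - 1)).
  by near: n; move/cvgrPdist_le : ul; apply; exact: divr_gt0.
apply: le_trans (@powR_lipschitz M _ _ _ _) _; rewrite ?u0 ?l0//=.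
  by rewrite /M; lra.
by rewrite mulrC -ler_pdivlMr.
Unshelve. all: by end_near. Qed.

Lemma powR_midpoint_ge0 (a b : R) : 0 <= a -> 0 <= b -> 0 <= D a b.
Proof.
move=> a0 b0; have s0 : 0 <= (a + b) / 2 by lra.
have := powR_tangent a0 s0; have := powR_tangent b0 s0; lra.
Qed.

(** Tangent inequalities at the midpoint [s] of [b, a] and at the midpoint [u] of
    [s, a]; strict convexity enters through the slopes at [s] and [u], without
    derivatives. *)
Lemma powR_midpoint_gap (a b s u : R) : 0 <= b <= a ->
  s = (a + b) / 2 -> u = (a + s) / 2 ->
  p * (a - b) / 8 * (u `^ (p - 1) - s `^ (p - 1)) <= D a b.
Proof.
move=> /andP[b0 ba] sE uE; have a0 := le_trans b0 ba.
have s0 : 0 <= s by lra.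
have u0 : 0 <= u by lra.
have := powR_tangent b0 s0; have := powR_tangent u0 s0.
have := powR_tangent a0 u0; rewrite -sE.
have -> : a - u = (a - b) / 4 by rewrite uE sE; field.
have -> : u - s = (a - b) / 4 by rewrite uE sE; field.
have -> : b - s = - ((a - b) / 2) by rewrite sE; field.
set X := u `^ (p - 1); set Y := s `^ (p - 1); lra.
Qed.

(** Uniform convexity in the form used for norms: if the defect is small, then
    [a] and [b] are close up to a fraction [e] of their size. *)
Lemma powR_uniformly_convex (e : R) : 0 < e -> exists2 C : R, 0 <= C &
  forall a b : R, 0 <= a -> 0 <= b ->
    `|a - b| `^ p <= e * (a `^ p + b `^ p) + C * D a b.
Proof.
move=> e0; pose d := e `^ p^-1.
have d0 : 0 < d by exact: powR_gt0.
have dp : d `^ p = e by rewrite -powRrM mulVf ?gt_eqF// powRr1// ltW.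
pose K := (1 + d / 4) `^ (p - 1) - 1.
have K0 : 0 < K.
  rewrite subr_gt0; suff : 1 `^ (p - 1) < (1 + d / 4) `^ (p - 1)
    by rewrite powR1.
  by rewrite gt0_ltr_powR ?subr_gt0// ?nnegrE; lra.
pose c := p * d / 8 * (2^-1 `^ (p - 1)) * K.
have c0 : 0 < c by rewrite /c !mulr_gt0// powR_gt0.
exists c^-1; first by rewrite invr_ge0 ltW.
have main (a b : R) : 0 <= b <= a ->
    `|a - b| `^ p <= e * (a `^ p + b `^ p) + c^-1 * D a b.
  move=> /andP[b0 ba]; have a0 := le_trans b0 ba.
  have D0 : 0 <= D a b by exact: powR_midpoint_ge0.
  rewrite ger0_norm ?subr_ge0//.
  have [abd|abd] := leP (a - b) (d * a).
    rewrite ler_wpDr ?mulr_ge0 ?invr_ge0 ?(ltW c0)//.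
    apply: (@le_trans _ _ ((d * a) `^ p)).
      by rewrite ge0_ler_powR ?(ltW p0)// nnegrE; lra.
    rewrite powRM// ?(ltW d0)// dp ler_wpM2l ?(ltW e0)// lerDl; exact: powR_ge0.
  apply: (@le_trans _ _ (c^-1 * D a b)); last first.
    by rewrite lerDr mulr_ge0 ?(ltW e0)// addr_ge0// powR_ge0.
  apply: (@le_trans _ _ (a `^ p)).
    by rewrite ge0_ler_powR ?(ltW p0)// ?nnegrE; lra.
  rewrite ler_pdivlMl//.
  have ba2 : 0 <= b <= a by rewrite b0.
  apply: le_trans (powR_midpoint_gap ba2 erefl erefl).
  set s := (a + b) / 2; set u := (a + s) / 2.
  have s0 : 0 <= s by rewrite /s; lra.
  have pm : 0 <= p - 1 by rewrite subr_ge0 ltW.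
  have us : K * s `^ (p - 1) <= u `^ (p - 1) - s `^ (p - 1).
    rewrite /K mulrBl mul1r lerD2r -powRM//; last by move: d0; lra.
    rewrite ge0_ler_powR// ?nnegrE; last 1 first.
    - have : d * s <= d * a by rewrite ler_pM2l// /s; lra.
      by move: abd; rewrite /u /s; lra.
    - by rewrite mulr_ge0//; move: d0; lra.
    - by rewrite /u; lra.
  have sa : 2^-1 `^ (p - 1) * a `^ (p - 1) <= s `^ (p - 1).
    by rewrite -powRM// ge0_ler_powR// ?nnegrE; rewrite ?mulr_ge0// /s; lra.
  rewrite -(mulr_powRB1 a0 p0) /c.
  have -> : p * d / 8 * 2^-1 `^ (p - 1) * K * (a * a `^ (p - 1)) =
    p * (d * a) / 8 * (K * (2^-1 `^ (p - 1) * a `^ (p - 1))) by lra.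
  apply: ler_pM; rewrite ?mulr_ge0 ?invr_ge0 ?powR_ge0 ?(ltW K0) ?(ltW p0)
    ?(ltW d0)//.
    by rewrite ler_pM2r// ler_pM2l// ltW.
  by apply: le_trans us; rewrite ler_pM2l.
move=> a b a0 b0; have [ba|ab] := leP b a; first by apply: main; rewrite b0.
have := main b a; rewrite a0 (ltW ab) distrC [b `^ p + _]addrC [b + a]addrC.
exact.
Qed.

End power_inequalities.

(** * The [L^p] seminorm on functions *)

Section Lp_seminorm.
Context d (T : measurableType d) (R : realType).
Variables (mu : {measure set T -> \bar R}) (p : R).
Hypothesis p1 : 1 < p.
Implicit Types f g h : T -> R.

Definition nrm f : R := fine ('N[mu]_(p%:E)[EFin \o f])%E.

Local Notation L := (Lfun mu p%:E).
Let p0 : 0 < p. Proof. exact: lt_trans p1. Qed.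
Let p1e : (1 <= p%:E)%E. Proof. exact: gt1_EFin_ge1. Qed.

Lemma Lfun_measurable f : f \in L -> measurable_fun setT f.
Proof. by move=> /sub_Lfun_mfun; rewrite inE. Qed.

Lemma LfunE f : measurable_fun setT f -> ('N[mu]_(p%:E)[EFin \o f] < +oo)%E ->
  f \in L.
Proof. by move=> mf Nf; rewrite inE; apply/andP; split; rewrite inE. Qed.

Lemma nrmE f : f \in L -> 'N[mu]_(p%:E)[EFin \o f]%E = (nrm f)%:E.
Proof.
move=> /sub_Lfun_finLfun; rewrite inE /finite_norm /nrm => Nf.
by rewrite fineK// ge0_fin_numE// Lnorm_ge0.
Qed.

Lemma nrm_ge0 f : 0 <= nrm f.
Proof. by rewrite fine_ge0// Lnorm_ge0. Qed.

Lemma LfunD f g : f \in L -> g \in L -> f \+ g \in L.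
Proof. exact: (Lfun_addr_closed mu p1e).2. Qed.

Lemma LfunZ (a : R) f : f \in L -> (fun x => a * f x) \in L.
Proof.
move=> fL; have := (Lfun_submod_closed mu p1e).2 a f (cst 0) fL.
rewrite (_ : _ + _ = fun x => a * f x); last first.
  by apply/funext => x; rewrite /= addr0.
by apply; have [] := Lfun_submod_closed mu p1e.
Qed.

Lemma LfunB f g : f \in L -> g \in L -> f \- g \in L.
Proof.
move=> fL gL; rewrite (_ : f \- g = f \+ (fun x => -1 * g x)).
  exact/LfunD/LfunZ.
by apply/funext => x /=; rewrite mulN1r.
Qed.

Lemma nrmD f g : f \in L -> g \in L -> nrm (f \+ g) <= nrm f + nrm g.
Proof.
move=> fL gL; rewrite -lee_fin EFinD -!nrmE//; last exact: LfunD.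
by apply: eminkowski => //; exact: Lfun_measurable.
Qed.

Lemma nrmZ (a : R) f : f \in L -> nrm (fun x => a * f x) = `|a| * nrm f.
Proof.
move=> fL; apply: EFin_inj; rewrite EFinM -!nrmE//; last exact: LfunZ.
exact: (@LnormZ _ _ _ mu _ p1e (Lfun_Sub p1e fL) a).
Qed.

Lemma nrmBC f g : nrm (f \- g) = nrm (g \- f).
Proof.
rewrite /nrm -(oppe_Lnorm mu (EFin \o (g \- f))); congr (fine (Lnorm _ _ _)).
by apply/funext => x /=; congr EFin; rewrite opprB.
Qed.

Lemma nrm_triangle f g h : f \in L -> g \in L -> h \in L ->
  nrm (f \- h) <= nrm (f \- g) + nrm (g \- h).
Proof.
move=> fL gL hL; apply: le_trans (nrmD (LfunB fL gL) (LfunB gL hL)).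
by rewrite le_eqVlt; apply/orP; left; apply/eqP; congr nrm;
  apply/funext => x /=;
  rewrite subrKA.
Qed.

Lemma le_nrm_dist f g : f \in L -> g \in L -> nrm f <= nrm g + nrm (f \- g).
Proof.
move=> fL gL; apply: le_trans (nrmD gL (LfunB fL gL)).
by rewrite le_eqVlt; apply/orP; left; apply/eqP; congr nrm;
  apply/funext => x /=;
  rewrite subrKC.
Qed.

Lemma measurable_normr_powR f : measurable_fun setT f ->
  measurable_fun setT (fun x => (`|f x| `^ p)%:E : \bar R).
Proof.
move=> mf; apply/measurable_EFinP.
by apply: (@measurableT_comp _ _ _ _ _ _ (@powR R ^~ p)) => //;
  exact: measurableT_comp.
Qed.

Lemma powR_nrm f : f \in L ->
  (\int[mu]_x (`|f x| `^ p)%:E = (nrm f `^ p)%:E)%E.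
Proof.
move=> fL; rewrite -poweR_EFin -nrmE// poweR_Lnorm ?gt_eqF//.
Qed.

Lemma ae_le_Lnorm f g : measurable_fun setT f -> measurable_fun setT g ->
  {ae mu, forall x, `|f x| <= `|g x|} ->
  ('N[mu]_(p%:E)[EFin \o f] <= 'N[mu]_(p%:E)[EFin \o g])%E.
Proof.
move=> mf mg fg; rewrite unlock /=.
apply: gt0_ler_poweR; rewrite ?invr_ge0 ?(ltW p0)// ?in_itv/= ?leey ?andbT.
- by apply: integral_ge0 => x _; rewrite lee_fin powR_ge0.
- by apply: integral_ge0 => x _; rewrite lee_fin powR_ge0.
- apply: ae_ge0_le_integral => //.
  + exact: measurable_normr_powR.
  + exact: measurable_normr_powR.
  + apply: filterS fg => x fgx _; rewrite lee_fin.
    by rewrite ge0_ler_powR ?(ltW p0)// nnegrE.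
Qed.

Lemma ae_eq_Lnorm f g : measurable_fun setT f -> measurable_fun setT g ->
  f = g %[ae mu] -> 'N[mu]_(p%:E)[EFin \o f]%E = 'N[mu]_(p%:E)[EFin \o g]%E.
Proof.
move=> mf mg fg; apply/eqP; rewrite eq_le !ae_le_Lnorm//.
- by apply: filterS fg => x /(_ I) ->.
- by apply: filterS fg => x /(_ I) ->.
Qed.

Lemma ae_le_nrm f g : f \in L -> g \in L ->
  {ae mu, forall x, `|f x| <= `|g x|} -> nrm f <= nrm g.
Proof.
move=> fL gL fg; rewrite -lee_fin -!nrmE//.
by apply: ae_le_Lnorm => //; exact: Lfun_measurable.
Qed.

Lemma ae_eq_nrm f g : f \in L -> g \in L -> f = g %[ae mu] -> nrm f = nrm g.
Proof.
by move=> fL gL fg; rewrite /nrm (ae_eq_Lnorm _ _ fg)//; exact: Lfun_measurable.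
Qed.

Lemma Lfun_dominated f g : measurable_fun setT f -> g \in L ->
  {ae mu, forall x, `|f x| <= `|g x|} -> f \in L.
Proof.
move=> mf gL fg; apply: LfunE => //.
apply: le_lt_trans (ae_le_Lnorm mf (Lfun_measurable gL) fg) _.
by rewrite nrmE ?ltry.
Qed.

Lemma Lfun_norm f : f \in L -> (fun x => `|f x|) \in L.
Proof.
move=> fL; apply: (Lfun_dominated _ fL).
  by apply: measurableT_comp => //; exact: Lfun_measurable.
by apply: aeW => x; rewrite normr_id.
Qed.

Lemma nrm_eq0 f : f \in L -> nrm f = 0 -> f = cst 0 %[ae mu].
Proof.
move=> fL f0; have := nrmE fL; rewrite f0 => /Lnorm_eq0_eq0.
have mf : measurable_fun setT (EFin \o f).
  by apply/measurable_EFinP; exact: Lfun_measurable.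
by move=> /(_ mf); rewrite lte_fin p0 => /(_ isT);
  apply: filterS => x /(_ I) [].
Qed.

Lemma nrm_dist_eq0 f g : f \in L -> g \in L ->
  (forall e, 0 < e -> nrm (f \- g) <= e) -> f = g %[ae mu].
Proof.
move=> fL gL fg; have : nrm (f \- g) = 0.
  by apply/eqP; rewrite eq_le nrm_ge0 andbT; apply/ler_addgt0Pr => e e0;
    rewrite add0r fg.
move/(nrm_eq0 (LfunB fL gL)); apply: filterS => x /(_ I) /eqP.
by rewrite /= subr_eq0 => /eqP.
Qed.

(** [powR_uniformly_convex] integrated: the defect of the energy at the midpoint
    controls the distance in [L^p]. *)
Lemma nrm_uniformly_convex (e : R) : 0 < e -> exists2 C : R, 0 <= C &
  forall f g, f \in L -> g \in L ->
    {ae mu, forall x, 0 <= f x} -> {ae mu, forall x, 0 <= g x} ->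
    nrm (f \- g) `^ p <= e * (nrm f `^ p + nrm g `^ p) +
      C * ((nrm f `^ p + nrm g `^ p) / 2
           - nrm (fun x => 2^-1 * (f x + g x)) `^ p).
Proof.
move=> e0; have [C C0 CP] := powR_uniformly_convex p1 e0; exists C => //.
move=> f g fL gL f0 g0.
have hL : (fun x => 2^-1 * (f x + g x)) \in L by exact/LfunZ/LfunD.
set h := (fun x => _) in hL *.
have mp k : k \in L -> measurable_fun setT (fun x => (`|k x| `^ p)%:E : \bar R).
  by move=> kL; exact/measurable_normr_powR/Lfun_measurable.
have ip0 (k : T -> R) (x : T) : (0 <= (`|k x| `^ p)%:E)%E
  by rewrite lee_fin powR_ge0.
have : (\int[mu]_x ((`|f x - g x| `^ p)%:E + C%:E * (`|h x| `^ p)%:E) <=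
        \int[mu]_x ((e + C / 2)%:E * ((`|f x| `^ p)%:E + (`|g x| `^ p)%:E)))%E.
  apply: ae_ge0_le_integral => //.
  - by move=> x _; rewrite adde_ge0// mule_ge0// lee_fin.
  - by apply: emeasurable_funD; [exact: (mp _ (LfunB fL gL))|
      apply: measurable_funeM; exact: mp].
  - by move=> x _; rewrite mule_ge0 ?adde_ge0// lee_fin addr_ge0 ?divr_ge0//
      ltW.
  - by apply: measurable_funeM; apply: emeasurable_funD; exact: mp.
  - apply: filterS2 f0 g0 => x f0 g0 _.
    suff : `|f x - g x| `^ p + C * `|h x| `^ p <=
        (e + C / 2) * (`|f x| `^ p + `|g x| `^ p) by rewrite -lee_fin.
    have := CP _ _ f0 g0.
    rewrite /h (ger0_norm f0) (ger0_norm g0) [`|2^-1 * _|]ger0_norm; last first.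
      by rewrite mulr_ge0// addr_ge0.
    by rewrite [2^-1 * _]mulrC; lra.
have mC k : k \in L -> measurable_fun setT (fun x =>
  C%:E * (`|k x| `^ p)%:E : \bar R)%E.
  by move=> kL; apply: measurable_funeM; exact: mp.
rewrite ge0_integralD//; last 3 first.
- exact: (mp _ (LfunB fL gL)).
- by move=> x _; rewrite mule_ge0// lee_fin.
- exact: mC.
rewrite !ge0_integralZl ?lee_fin//; last 4 first.
- by apply: emeasurable_funD; exact: mp.
- by move=> x _; rewrite adde_ge0.
- by rewrite addr_ge0 ?divr_ge0// ltW.
- exact: mp.
rewrite ge0_integralD//; last 2 first.
- exact: mp.
- exact: mp.
rewrite (powR_nrm (LfunB fL gL)) (powR_nrm hL) (powR_nrm fL) (powR_nrm gL).
move=> le_int; suff : nrm (f \- g) `^ p + C * nrm h `^ p <=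
  (e + C / 2) * (nrm f `^ p + nrm g `^ p) by lra.
by rewrite -lee_fin.
Qed.

End Lp_seminorm.

(** * Completeness of [L^p] *)

Section limn_einf_bounds.
Context {R : realType}.
Implicit Types u : (\bar R)^nat.
Local Open Scope ereal_scope.

Lemma limn_einf_le_often u c :
  (forall N, exists2 n, (N <= n)%N & u n <= c) -> limn_einf u <= c.
Proof.
move=> uc; rewrite limn_einf_lim; apply: lime_le; first exact: is_cvg_einfs.
apply: nearW => N; have [n Nn un] := uc N.
by apply: le_trans un; apply: ereal_inf_lbound; exists n.
Qed.

Lemma limn_einf_lt_often u a : limn_einf u < a ->
  forall N, exists2 n, (N <= n)%N & u n < a.
Proof.
move=> ua N; have /ereal_inf_lt[_ [n /= Nn <-] una] : einfs u N < a.
  apply: le_lt_trans ua; rewrite limn_einf_lim.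
  by rewrite (cvg_lim _ (@cvg_einfs_sup _ u))//; apply: ereal_sup_ubound;
    exists N.
by exists n.
Qed.

End limn_einf_bounds.

Lemma geometric_increments_cvg (R : realType) (h : nat -> R) (A : R) :
  (forall j, `|h j.+1 - h j| <= A * 2^-1 ^+ j) -> cvgn h.
Proof.
move=> hA; have A0 : 0 <= A.
  by have := hA 0%N; rewrite expr0 mulr1; exact: le_trans.
have hE : h = fun n => h 0%N + series (fun j => h j.+1 - h j) n.
  by apply/funext => n; rewrite seriesEnat/= telescope_sumr// subrKC.
rewrite hE; apply: is_cvgD; first exact: is_cvg_cst.
apply: normed_cvg; apply: (@series_le_cvg _ _ (geometric A 2^-1)) => //.
- by move=> n /=.
- by move=> n; apply: geometric_ge0.
- by apply: is_cvg_geometric_series; rewrite ger0_norm// invf_lt1// ltr1n.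
Qed.

Section riesz_fischer.
Context d (T : measurableType d) (R : realType).
Variables (mu : {measure set T -> \bar R}) (p : R).
Hypothesis p1 : 1 < p.
Local Notation L := (Lfun mu p%:E).
Local Notation nrm := (nrm mu p).
Let p0 : 0 < p. Proof. exact: lt_trans p1. Qed.

(** One factor of the rate pays for rescaling the increments of [h] by [2 ^+ j],
    the other makes the [p]-th powers of the rescaled increments summable; so
    these are bounded almost everywhere, and the increments decay like [2^-j]. *)
Lemma fast_cauchy_ae_cvg (h : nat -> T -> R) : (forall j, h j \in L) ->
  (forall j, nrm (h j.+1 \- h j) <= 2^-1 ^+ j * 2^-1 ^+ j.+1) ->
  {ae mu, forall x, cvgn (h ^~ x)}.
Proof.
move=> hL hfast.
pose D j := h j.+1 \- h j.
have DL j : D j \in L by exact: LfunB.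
pose phi j x : \bar R := (`|2 ^+ j * D j x| `^ p)%:E.
have phi0 j x : (0 <= phi j x)%E by rewrite lee_fin powR_ge0.
have mphi j : measurable_fun setT (phi j).
  by apply: measurable_normr_powR; exact: (Lfun_measurable (LfunZ p1 _ (DL j))).
have iphi j : (\int[mu]_x phi j x <= (1 / (2 ^ (j + 1))%:R)%:E)%E.
  rewrite (powR_nrm p1 (LfunZ p1 _ (DL j))) lee_fin nrmZ// ger0_norm
    ?exprn_ge0//.
  have le1 : 2 ^+ j * nrm (D j) <= 2^-1 ^+ j.+1.
    apply: le_trans (ler_wpM2l _ (hfast j)) _; first exact: exprn_ge0.
    by rewrite mulrA -exprMn mulfV// expr1n mul1r.
  have half0 : 0 < 2^-1 ^+ j.+1 :> R by rewrite exprn_gt0.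
  apply: (@le_trans _ _ ((2^-1 ^+ j.+1) `^ p)).
    by rewrite ge0_ler_powR ?(ltW p0)// nnegrE ?(ltW half0)// mulr_ge0//
      nrm_ge0.
  apply: le_trans (ge1r_powR _ (ltW p1)) _.
    by rewrite half0 exprn_ile1// invf_le1// ler1n.
  by rewrite addn1 natrX div1r exprVn.
have mS : measurable_fun setT (fun x => \sum_(j <oo) phi j x)%E.
  by apply: ge0_emeasurable_sum => // k x _ _; exact: phi0.
have S0 x : (0 <= \sum_(j <oo) phi j x)%E.
  by apply: nneseries_ge0 => k _ _; exact: phi0.
have : mu.-integrable setT (fun x => \sum_(j <oo) phi j x)%E.
  apply/integrableP; split => //.
  under eq_integral do rewrite gee0_abs//.
  rewrite integral_nneseries//; apply: (@le_lt_trans _ _ 1%E); last exact: ltry.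
  have := @cvg_geometric_eseries_half R 1 0.
  rewrite expr0 divr1 => /cvg_lim <-//.
  apply: lee_nneseries => j _; last exact: iphi.
  by move=> _; apply: integral_ge0 => x _; exact: phi0.
move=> /(integrable_ae measurableT); apply: filterS => x /(_ I) Sfin.
pose A := fine (\sum_(j <oo) phi j x)%E `^ p^-1.
apply: (@geometric_increments_cvg _ _ A) => j.
have phiS : (phi j x <= \sum_(j <oo) phi j x)%E.
  apply: le_trans (nneseries_lim_ge j.+1 _); last by move=> *; exact: phi0.
  by rewrite big_nat_recr//= leeDr// sume_ge0.
have : `|2 ^+ j * D j x| <= A.
  have le_pow : `|2 ^+ j * D j x| `^ p <= fine (\sum_(j <oo) phi j x)%E.
    by rewrite -lee_fin fineK.
  rewrite [leLHS](_ : _ = (`|2 ^+ j * D j x| `^ p) `^ p^-1); last first.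
    by rewrite -powRrM mulfV ?gt_eqF// powRr1.
  by rewrite ge0_ler_powR ?invr_ge0 ?(ltW p0)// nnegrE ?powR_ge0 ?fine_ge0.
rewrite normrM ger0_norm ?exprn_ge0// exprVn ler_pdivlMr ?exprn_gt0//.
by rewrite mulrC.
Qed.

(** Riesz-Fischer: a fast subsequence converges almost everywhere, and Fatou's
    lemma identifies the pointwise limit as the limit in norm. *)
Lemma Lp_complete (g : nat -> T -> R) : (forall n, g n \in L) ->
  (forall e : R, 0 < e -> exists N, forall n m, (N <= n)%N -> (N <= m)%N ->
     nrm (g n \- g m) <= e) ->
  exists2 G, G \in L & forall e : R, 0 < e ->
    exists N, forall n, (N <= n)%N -> nrm (g n \- G) <= e.
Proof.
move=> gL cau.
have gm n : measurable_fun setT (g n) by exact: Lfun_measurable.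
have /choice[k kP] (j : nat) : exists N, forall n m, (N <= n)%N -> (N <= m)%N ->
    nrm (g n \- g m) <= 2^-1 ^+ j * 2^-1 ^+ j.+1.
  by apply: cau; rewrite mulr_gt0// exprn_gt0.
(* Partial sums turn the ranks [k] into a nondecreasing sequence. *)
pose K j := (\sum_(i < j.+1) k i)%N.
have kK j : (k j <= K j)%N by rewrite /K big_ord_recr/= leq_addl.
have KS j : (K j <= K j.+1)%N by rewrite /K [leqRHS]big_ord_recr/= leq_addr.
have Kmono : {homo K : i j / (i <= j)%N} by apply: homo_leq => //;
  exact: leq_trans.
pose h j := g (K j).
have hae : {ae mu, forall x, cvgn (h ^~ x)}.
  apply: fast_cauchy_ae_cvg => j; first exact: gL.
  by apply: kP => //; exact: leq_trans (kK j) (KS j).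
pose G x := fine (limn_esup (fun j => (h j x)%:E)).
have mG : measurable_fun setT G.
  apply: measurableT_comp => //.
  by apply: measurable_fun_limn_esup => j; apply/measurable_EFinP; exact: gm.
have hG : {ae mu, forall x, h ^~ x @ \oo --> G x}.
  apply: filterS hae => x /cvg_ex[l hl]; rewrite /G.
  have /cvg_limn_einf_sup[_ ->] : (EFin \o h ^~ x) @ \oo --> l%:E.
    by apply: cvg_comp hl _; exact: cvg_refl.
  exact: hl.
have close j n : (K j <= n)%N ->
    ('N[mu]_(p%:E)[EFin \o (g n \- G)%R] <= (2^-1 ^+ j)%:E)%E.
  move=> jn; set e := 2^-1 ^+ j; have e0 : 0 <= e by rewrite exprn_ge0.
  have near_l l : (j <= l)%N -> nrm (g n \- h l) <= e.
    move=> jl; apply: le_trans (kP j _ _ (leq_trans (kK j) jn) _) _.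
      exact: leq_trans (kK j) (Kmono _ _ jl).
    have half1 : 2^-1 ^+ j.+1 <= 1 :> R by apply: exprn_ile1; lra.
    by rewrite ler_piMr.
  pose w l x : \bar R := (`|g n x - h l x| `^ p)%R%:E.
  have mw l : measurable_fun setT (w l).
    exact: (measurable_normr_powR p (measurable_funB (gm n) (gm _))).
  have w0 l x : (0 <= w l x)%E by rewrite lee_fin powR_ge0.
  rewrite unlock /= [leRHS](_ : _ = (e `^ p)%:E `^ p^-1)%E; last first.
    by rewrite poweR_EFin -powRrM mulfV ?gt_eqF// powRr1.
  apply: gt0_ler_poweR; rewrite ?invr_ge0 ?(ltW p0)// ?in_itv/= ?leey ?andbT.
  - by apply: integral_ge0 => x _; rewrite lee_fin powR_ge0.
  - by rewrite lee_fin powR_ge0.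
  apply: (@le_trans _ _ (\int[mu]_x limn_einf (w ^~ x))%E).
    apply: ae_ge0_le_integral => //.
    - by apply: measurable_normr_powR; exact: measurable_funB.
    - by move=> x _; rewrite limn_einf_lim; apply: lime_ge;
        [exact: is_cvg_einfs|apply: nearW => N;
          apply: le_ereal_inf_tmp => _ [l _ <-]].
    - rewrite (_ : (fun x => _) = fun x => (- limn_esup (fun l =>
        - w l x))%E)//.
      by apply: measurableT_comp => //; apply: measurable_fun_limn_esup => l;
        exact: measurableT_comp.
    - apply: filterS hG => x hx _.
      have /cvg_limn_einf_sup[-> _] : w ^~ x @ \oo --> (`|g n x - G x| `^ p)%:E.
        have wl : `|g n x - h l x| @[l --> \oo] --> `|g n x - G x|.
          by apply: cvg_norm; apply: cvgB => //; exact: cvg_cst.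
        by apply: cvg_comp (cvg_powR p1 _ wl) _ => //; exact: cvg_refl.
      by [].
  apply: le_trans (fatou _ measurableT mw _) _ => //.
  apply: limn_einf_le_often => N; exists (maxn N j); first exact: leq_maxl.
  rewrite /w (powR_nrm p1 (LfunB p1 (gL n) (gL _))) lee_fin.
  by rewrite ge0_ler_powR ?(ltW p0)// ?nnegrE ?nrm_ge0// near_l// leq_maxr.
have GL : G \in L.
  have gGL : g (K 0%N) \- G \in L.
    apply: LfunE; first exact: measurable_funB.
    exact: le_lt_trans (close 0%N _ (leqnn _)) (ltry _).
  have := LfunB p1 (gL (K 0%N)) gGL.
  rewrite (_ : _ \- _ = G)//; apply/funext => x /=; rewrite opprB addrC subrK//.
exists G => // e e0.
have [j je] : exists j, 2^-1 ^+ j <= e.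
  have : 2^-1 ^+ j @[j --> \oo] --> (0 : R).
    by apply: cvg_expr; rewrite ger0_norm// invf_lt1// ltr1n.
  move=> /cvgr0Pnorm_le /(_ e e0) [j _ /(_ j (leqnn j))].
  by rewrite /= ger0_norm ?exprn_ge0// => je; exists j.
exists (K j) => n jn; apply: le_trans je.
by rewrite -lee_fin -nrmE ?close// LfunB.
Qed.
End riesz_fischer.

(** * Lipschitz constants and the asymptotic Lipschitz constant *)

Section lipschitz.
Context {R : realType} (Y : Type) (d : Y -> Y -> \bar R).
Hypothesis d0 : forall x y, (0 <= d x y)%E.
Implicit Types (f g : Y -> R) (A B : set Y) (a b : R).
Local Open Scope ereal_scope.

Definition lipschitz_on a f A :=
  forall y z, A y -> A z -> `|f y - f z|%:E <= a%:E * d y z.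

Lemma Lip_ge0 f A : 0 <= Lip d f A.
Proof. by apply: le_ereal_inf_tmp => L [L0 _]. Qed.

Lemma Lip_le a f A : (0 <= a)%R -> lipschitz_on a f A -> Lip d f A <= a%:E.
Proof. by move=> a0 fa; apply: ereal_inf_lbound; split; rewrite ?lee_fin. Qed.

Lemma Lip_lt a f A : Lip d f A < a%:E -> lipschitz_on a f A.
Proof.
move=> /ereal_inf_lt[L [L0 fL] La] y z Ay Az.
by apply: le_trans (fL y z Ay Az) _; rewrite lee_wpmul2r// ltW.
Qed.

Lemma Lip_subset f A B : A `<=` B -> Lip d f A <= Lip d f B.
Proof.
move=> AB; apply: ereal_inf_le_tmp => L [L0 fL]; split=> // y z Ay Az.
by apply: fL; exact: AB.
Qed.

Lemma lipschitz_on_convex (t : R) a b f g A : (0 <= t <= 1)%R ->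
  (0 <= a)%R -> (0 <= b)%R -> lipschitz_on a f A -> lipschitz_on b g A ->
  lipschitz_on (t * a + (1 - t) * b) (fun x => t * f x + (1 - t) * g x)%R A.
Proof.
move=> /andP[t0 t1] a0 b0 fa gb y z Ay Az.
have t1' : (0 <= 1 - t)%R by rewrite subr_ge0.
apply: (@le_trans _ _ (t%:E * `|f y - f z|%:E + (1 - t)%:E * `|g y - g z|%:E)).
  have -> : (t * f y + (1 - t) * g y - (t * f z + (1 - t) * g z) =
    t * (f y - f z) + (1 - t) * (g y - g z))%R by ring.
  rewrite -!EFinM -EFinD lee_fin.
  by apply: le_trans (ler_normD _ _) _;
    rewrite !normrM (ger0_norm t0) (ger0_norm t1').
have -> : (t * a + (1 - t) * b)%:E = t%:E * a%:E + (1 - t)%:E * b%:E by [].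
rewrite ge0_muleDl ?mule_ge0 ?lee_fin// -!muleA.
by rewrite leeD// lee_wpmul2l ?lee_fin// ?fa ?gb.
Qed.

End lipschitz.

Lemma bounded_funI (R : realType) (T : Type) (M : R) (f : T -> R) :
  (forall x, `|f x| <= M) -> bounded_fun f.
Proof.
move=> fM; exists M; split; first exact: num_real.
by move=> N MN x _ /=; exact: le_trans (fM x) (ltW MN).
Qed.

Section slope.
Context {R : realType} (X : emtmSpace R).
Local Notation d := (@emdist R X).
Local Notation m := (@emeas R X).
Implicit Types (f g : X -> R) (x : X).
Local Open Scope ereal_scope.

Lemma emdist_ge0 (x y : X) : 0 <= d x y.
Proof. by have [] := emt_edist (emtm_emt X). Qed.

Lemma lip_ge0 f x : 0 <= lip f x.
Proof. by apply: le_ereal_inf_tmp => _ [U _ <-]; exact: Lip_ge0. Qed.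

Lemma lip_le f x U : nbhs x U -> lip f x <= Lip d f U.
Proof. by move=> xU; apply: ereal_inf_lbound; exists U. Qed.

Lemma lip_lt f x (a : R) : lip f x < a%:E ->
  exists2 U : set X, open_nbhs x U & Lip d f U < a%:E.
Proof.
move=> /ereal_inf_lt[_ [U xU <-] Ua].
move: xU; rewrite nbhsE => -[V xV VU]; exists V => //.
exact: le_lt_trans (Lip_subset d f VU) Ua.
Qed.

Lemma lip_le_bound f x (a : R) : (0 <= a)%R -> (forall e, 0 < e ->
  exists2 U : set X, nbhs x U & lipschitz_on d (a + e) f U)%R ->
    lip f x <= a%:E.
Proof.
move=> a0 fa; apply/lee_addgt0Pr => e e0; have [U xU fU] := fa e e0.
apply: le_trans (lip_le f xU) _; rewrite -EFinD; apply: Lip_le => //.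
by rewrite addr_ge0// ltW.
Qed.

Lemma Lip_b_bounded f : Lip_b d f -> exists2 M : R, (0 < M)%R &
  forall x, (`|f x| <= M)%R.
Proof.
move=> [_ /pinfty_ex_gt0[M M0 fM] _]; exists M => // x; exact: fM.
Qed.

Lemma Lip_b_lipschitz f : Lip_b d f -> exists2 L : R, (0 < L)%R &
  lipschitz_on d L f setT.
Proof.
move=> [_ _ fL]; exists (fine (Lip d f setT) + 1)%R.
  by rewrite ltr_wpDl// fine_ge0// Lip_ge0.
apply: Lip_lt; first exact: emdist_ge0.
by rewrite EFinD fineK ?ge0_fin_numE ?Lip_ge0// lteDl ?ge0_fin_numE ?Lip_ge0//
  lte_fin.
Qed.

Lemma lip_fin f x : Lip_b d f -> lip f x \is a fin_num.
Proof.
move=> [_ _ fL]; rewrite ge0_fin_numE ?lip_ge0//.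
by apply: le_lt_trans fL; apply: lip_le; exact: filterT.
Qed.

Definition slope f x : R := fine (lip f x).

Lemma slopeE f x : Lip_b d f -> (slope f x)%:E = lip f x.
Proof. by move=> bf; rewrite fineK// lip_fin. Qed.

Lemma slope_ge0 f x : (0 <= slope f x)%R.
Proof. by rewrite fine_ge0// lip_ge0. Qed.

Lemma lip_convex (t : R) f g x : (0 <= t <= 1)%R -> Lip_b d f -> Lip_b d g ->
  lip (fun x => t * f x + (1 - t) * g x)%R x <=
    t%:E * lip f x + (1 - t)%:E * lip g x.
Proof.
move=> t01 bf bg; have /andP[t0 t1] := t01.
rewrite -(@slopeE f x bf) -(@slopeE g x bg).
have -> : t%:E * (slope f x)%:E + (1 - t)%:E * (slope g x)%:E =
  (t * slope f x + (1 - t) * slope g x)%:E by [].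
apply: lip_le_bound.
  by rewrite addr_ge0 ?mulr_ge0 ?slope_ge0// subr_ge0.
move=> e e0.
have lt_slope h : Lip_b d h -> lip h x < (slope h x + e)%:E.
  by move=> bh; rewrite EFinD slopeE// lteDl ?lip_fin ?lte_fin.
have [U [oU Ux] fU] := lip_lt (lt_slope f bf).
have [V [oV Vx] gV] := lip_lt (lt_slope g bg).
exists (U `&` V); first by apply: filterI; exact: open_nbhs_nbhs.
rewrite (_ : (_ + e = t * (slope f x + e) + (1 - t) * (slope g x + e))%R);
  last by ring.
apply: lipschitz_on_convex => //.
- by rewrite addr_ge0 ?slope_ge0// ltW.
- by rewrite addr_ge0 ?slope_ge0// ltW.
- move=> y z [Uy _] [Uz _]; apply: (Lip_lt _ fU) => //; exact: emdist_ge0.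
- move=> y z [_ Vy] [_ Vz]; apply: (Lip_lt _ gV) => //; exact: emdist_ge0.
Qed.

Lemma Lip_b_convex (t : R) f g : (0 <= t <= 1)%R -> Lip_b d f -> Lip_b d g ->
  Lip_b d (fun x => t * f x + (1 - t) * g x)%R.
Proof.
move=> t01 bf bg; have /andP[t0 t1] := t01; split.
- have [[cf _ _] [cg _ _]] := (bf, bg); move=> x.
  by apply: cvgD; apply: cvgM;
    [exact: cvg_cst|exact: cf|exact: cvg_cst|exact: cg].
- have [M M0 fM] := Lip_b_bounded bf; have [N N0 gN] := Lip_b_bounded bg.
  apply: (@bounded_funI _ _ (M + N)%R) => x.
  apply: le_trans (ler_normD _ _) _; rewrite !normrM ger0_norm//.
  rewrite (@ger0_norm _ (1 - t)%R) ?subr_ge0// lerD//.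
    by apply: le_trans (fM x); rewrite ler_piMl.
  by apply: le_trans (gN x); rewrite ler_piMl// gerBl.
- have [L L0 fL] := Lip_b_lipschitz bf; have [K K0 gK] := Lip_b_lipschitz bg.
  apply: le_lt_trans (ltry (t * L + (1 - t) * K)%R); apply: Lip_le.
    by rewrite addr_ge0 ?mulr_ge0 ?subr_ge0// ltW.
  by apply: lipschitz_on_convex => //; exact: ltW.
Qed.

(** Upper semicontinuity of [lip], the source of its measurability. *)
Lemma open_lip_lt f (a : R) : open [set x | lip f x < a%:E].
Proof.
rewrite openE => x /lip_lt[U [oU Ux] fU].
move: (oU); rewrite openE => /(_ x Ux); apply: filterS => y Uy /=.
by apply: le_lt_trans fU; apply: lip_le; exact: open_nbhs_nbhs.
Qed.

End slope.

(** * The Cheeger energy *)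

Section cheeger.
Context {R : realType} (X : emtmSpace R) (p : R) (p1 : 1 < p).
Local Notation d := (@emdist R X).
Local Notation m := (@emeas R X).
Local Notation L := (Lfun m p%:E).
Local Notation nrm := (nrm m p).
Implicit Types (f g u : X -> R).
Let p0 : 0 < p. Proof. exact: lt_trans p1. Qed.

(** The almost-everywhere filter lives on [borel X]; for predicates on [X],
    which is only convertible to it, [filterS] does not find the filter
    instance. *)
Lemma ae_mono (P Q : X -> Prop) : (forall x, P x -> Q x) ->
  {ae m, forall x, P x} -> {ae m, forall x, Q x}.
Proof. exact: (@filterS (borel X) (almost_everywhere m) _ P Q). Qed.

Lemma ae_mono2 (P Q S : X -> Prop) : (forall x, P x -> Q x -> S x) ->
  {ae m, forall x, P x} -> {ae m, forall x, Q x} -> {ae m, forall x, S x}.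
Proof. exact: (@filterS2 (borel X) (almost_everywhere m) _ P Q S). Qed.

Lemma slope_ae_ge0 f : {ae m, forall x, 0 <= slope f x}.
Proof. by apply: aeW => x; exact: slope_ge0. Qed.

Lemma measurable_open (U : set X) : open U -> measurable (U : set (borel X)).
Proof. by move=> oU; exact: sub_sigma_algebra. Qed.

Lemma measurable_usc f : (forall a, open [set x | f x < a]) ->
  measurable_fun setT (f : borel X -> R).
Proof.
move=> of_; apply: (measurability _ (RGenInftyO.measurableE R)).
move=> _ [_ [a ->] <-]; rewrite setTI; apply: measurable_open.
by rewrite (_ : _ @^-1` _ = [set x | f x < a]);  last by apply/seteqP;
  split=> x /=; rewrite in_itv.
Qed.

Lemma measurable_continuous f : continuous f ->
  measurable_fun setT (f : borel X -> R).
Proof.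
move=> cf; apply: measurable_usc => a.
rewrite (_ : mkset _ = f @^-1` [set y | y < a])//.
by move/continuousP : cf; apply; exact: open_lt.
Qed.

Lemma measurable_slope f : Lip_b d f ->
  measurable_fun setT (slope f : borel X -> R).
Proof.
move=> bf; apply: measurable_usc => a.
rewrite (_ : mkset _ = [set x | (lip f x < a%:E)%E]); first exact: open_lip_lt.
by apply/seteqP; split=> x /=; rewrite -slopeE// lte_fin.
Qed.

Lemma bounded_Lfun f (M : R) : measurable_fun setT (f : borel X -> R) ->
  (forall x, `|f x| <= M) -> (f : borel X -> R) \in L.
Proof.
move=> mf fM; apply: (Lfun_dominated p1 mf (Lfun_cst m M p)).
by apply: aeW => x /=; apply: le_trans (fM x) _; exact: ler_norm.
Qed.

Lemma Lip_b_Lfun f : Lip_b d f -> f \in L.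
Proof.
move=> bf; have [M _ fM] := Lip_b_bounded bf.
by apply: bounded_Lfun fM; apply: measurable_continuous; case: bf.
Qed.

Lemma slope_le_lipschitz f (K : R) : Lip_b d f -> 0 <= K ->
  lipschitz_on d K f setT ->
  forall x, slope f x <= K.
Proof.
move=> bf K0 fK x; rewrite -lee_fin slopeE//.
by apply: le_trans (lip_le f filterT) _; exact: Lip_le.
Qed.

Lemma slope_Lfun f : Lip_b d f -> slope f \in L.
Proof.
move=> bf; have [K K0 fK] := Lip_b_lipschitz bf.
apply: (@bounded_Lfun _ K); first exact: measurable_slope.
by move=> x; rewrite ger0_norm ?slope_ge0//; apply: slope_le_lipschitz => //;
  exact: ltW.
Qed.

Lemma int_lip f : Lip_b d f ->
  (\int[m]_x (lip f x `^ p) = (nrm (slope f) `^ p)%:E)%E.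
Proof.
move=> bf; rewrite -powR_nrm ?slope_Lfun//; apply: eq_integral => x _.
by rewrite -slopeE// poweR_EFin ger0_norm// slope_ge0.
Qed.

Lemma cvg_LpP (u : nat -> X -> R) f : (forall n, Lip_b d (u n)) -> f \in L ->
  cvg_Lp p u f <-> nrm (u n \- f) @[n --> \oo] --> (0 : R).
Proof.
move=> bu fL; rewrite /cvg_Lp.
rewrite (_ : (fun n => _) = EFin \o (fun n => nrm (u n \- f))); last first.
  by apply/funext => n /=; rewrite nrmE// LfunB// Lip_b_Lfun.
by split=> [/fine_cvg|h]; [exact|apply: cvg_comp h _; exact: cvg_refl].
Qed.

Lemma CE_lt f (a : \bar R) : f \in L -> (CE p f < a)%E -> forall e : R, 0 < e ->
  exists u, [/\ Lip_b d u, nrm (u \- f) < e & ((nrm (slope u) `^ p)%:E < a)%E].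
Proof.
move=> fL /ereal_inf_lt[_ [u [bu uf] <-] ua] e e0.
have /cvgrPdist_lt/(_ e e0)[N _ uN] := (cvg_LpP bu fL).1 uf.
have [n Nn una] := limn_einf_lt_often ua N; exists (u n); split=> //.
  by have := uN n Nn; rewrite sub0r normrN ger0_norm ?nrm_ge0.
by rewrite -int_lip.
Qed.

Lemma CE_le f (a : \bar R) : f \in L -> (forall e : R, 0 < e ->
  exists u, [/\ Lip_b d u, nrm (u \- f) <= e &
                ((nrm (slope u) `^ p)%:E <= a)%E]) ->
  (CE p f <= a)%E.
Proof.
move=> fL fa.
have /choice[u uP] (n : nat) : exists u, [/\ Lip_b d u,
    nrm (u \- f) <= n.+1%:R^-1 & ((nrm (slope u) `^ p)%:E <= a)%E].
  exact: fa.
apply: le_trans (ereal_inf_lbound _) _.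
  exists u => //; split=> [n|]; first by case: (uP n).
  apply/cvg_LpP => //; first by move=> n; case: (uP n).
  apply: (@squeeze_cvgr _ _ _ _ (cst 0) (fun n => n.+1%:R^-1)).
  - by apply: nearW => n; rewrite nrm_ge0; case: (uP n).
  - exact: cvg_cst.
  - exact: cvg_harmonic.
apply: limn_einf_le_often => N; exists N => //.
by have [bu _ ua] := uP N; rewrite int_lip.
Qed.

Lemma CE_ge0 f : (0 <= CE p f)%E.
Proof.
apply: le_ereal_inf_tmp => _ [u [bu _] <-]; rewrite limn_einf_lim.
apply: lime_ge; first exact: is_cvg_einfs.
apply: nearW => n; apply: le_ereal_inf_tmp => _ [k _ <-].
by apply: integral_ge0 => x _; exact: poweR_ge0.
Qed.

End cheeger.

(** * Minimal relaxed gradients *)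

Section relaxed_gradients.
Context {R : realType} (X : emtmSpace R) (p : R) (p1 : 1 < p).
Local Notation d := (@emdist R X).
Local Notation m := (@emeas R X).
Local Notation L := (Lfun m p%:E).
Local Notation nrm := (nrm m p).
Implicit Types (f g u G H : X -> R).
Let p0 : 0 < p. Proof. exact: lt_trans p1. Qed.

(** The strong closure of the majorants of slopes, along approximations of [f].
    Unlike relaxed gradients, these are defined without weak convergence, and by
    balls rather than sequences, so that convexity, stability under pullback and
    the comparison with [CE] are immediate. *)
Definition strong_gradient f G := G \in L /\ forall e : R, 0 < e ->
  exists u g, [/\ Lip_b d u, g \in L, forall x, slope u x <= g x,
                  nrm (u \- f) < e & nrm (g \- G) < e].

Lemma strong_gradient_ge0 f G : strong_gradient f G ->
  {ae m, forall x, 0 <= G x}.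
Proof.
move=> [GL fG]; have aGL := Lfun_norm p1 GL.
suff : G = (fun x => `|G x|) %[ae m] by apply: ae_mono => x /(_ I) ->.
apply: (nrm_dist_eq0 p1) => // e e0; have [|u [g [_ gL ug _ gG]]] := fG (e / 2).
  by rewrite divr_gt0.
apply: le_trans (nrm_triangle p1 GL gL aGL) _.
rewrite nrmBC [leRHS](splitr e) lerD ?ltW//; apply: le_lt_trans gG.
apply: ae_le_nrm => //; [exact: LfunB|exact: LfunB|apply: aeW => x /=].
rewrite -{1}[g x]ger0_norm ?(le_trans (slope_ge0 u x))//.
exact: ler_dist_dist.
Qed.

Lemma le_powR_of_le_add (a b : R) : 0 <= b ->
  (forall e, 0 < e -> a <= (b + e) `^ p) -> a <= b `^ p.
Proof.
move=> b0 ab.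
have : (b + n.+1%:R^-1) `^ p @[n --> \oo] --> b `^ p.
  apply: cvg_powR => //; first by move=> n; rewrite addr_ge0.
  by rewrite -[X in _ --> X]addr0; apply: cvgD;
    [exact: cvg_cst|exact: cvg_harmonic].
move=> /(ler_cvg_to (cvg_cst a)); apply; apply: nearW => n; exact: ab.
Qed.

Lemma CE_strong_gradient f G : f \in L -> strong_gradient f G ->
  (CE p f <= (nrm G `^ p)%:E)%E.
Proof.
move=> fL [GL fG].
have bound e : 0 < e -> (CE p f <= ((nrm G + e) `^ p)%:E)%E.
  move=> e0; apply: CE_le => // r r0.
  have [|u [g [bu gL ug uf gG]]] := fG (Num.min e r);
    first by rewrite lt_min e0.
  exists u; split=> //; first by rewrite (le_trans (ltW uf))// ge_min lexx orbT.
  rewrite lee_fin ge0_ler_powR ?(ltW p0)// ?nnegrE ?nrm_ge0//.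
    by rewrite addr_ge0 ?nrm_ge0// ltW.
  apply: (@le_trans _ _ (nrm g)).
    apply: ae_le_nrm => //; first exact: slope_Lfun.
    by apply: aeW => x; rewrite !ger0_norm ?slope_ge0// (le_trans (slope_ge0 u
      x)).
  apply: le_trans (le_nrm_dist p1 gL GL) _;
    rewrite lerD2l (le_trans (ltW gG))//.
  by rewrite ge_min lexx.
have : CE p f \is a fin_num.
  by rewrite ge0_fin_numE ?CE_ge0// (le_lt_trans (bound 1 ltr01))// ltry.
move=> /fineK CEf; rewrite -CEf lee_fin.
apply: le_powR_of_le_add; first exact: nrm_ge0.
by move=> e e0; rewrite -lee_fin CEf bound.
Qed.

Lemma nrm_convex_dist (t : R) (a b c e : X -> R) : 0 <= t <= 1 ->
  a \in L -> b \in L -> c \in L -> e \in L ->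
  nrm ((fun x => t * a x + (1 - t) * b x) \-
       (fun x => t * c x + (1 - t) * e x)) <=
  t * nrm (a \- c) + (1 - t) * nrm (b \- e).
Proof.
move=> /andP[t0 t1] aL bL cL eL.
have [acL beL] := (LfunB p1 aL cL, LfunB p1 bL eL).
rewrite (_ : _ \- _ =
    (fun x => t * (a \- c) x) \+ (fun x => (1 - t) * (b \- e) x)); last first.
  by apply/funext => x /=; ring.
apply: le_trans (nrmD p1 (LfunZ p1 _ acL) (LfunZ p1 _ beL)) _.
by rewrite !nrmZ// !ger0_norm// subr_ge0.
Qed.

Lemma Lfun_convex (t : R) f g : f \in L -> g \in L ->
  (fun x => t * f x + (1 - t) * g x) \in L.
Proof. by move=> fL gL; apply: (LfunD p1); exact: LfunZ. Qed.

Lemma convex_same (t : R) f : (fun x => t * f x + (1 - t) * f x) = f.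
Proof. by apply/funext => x; ring. Qed.

Lemma convex_lt (t x y e : R) : 0 <= t <= 1 -> x < e -> y < e ->
  t * x + (1 - t) * y < e.
Proof.
move=> /andP[]; rewrite le_eqVlt => /predU1P[<- _ _ ye|t0 t1 xe ye].
  by rewrite mul0r add0r subr0 mul1r.
have : t * x < t * e by rewrite ltr_pM2l.
have : (1 - t) * y <= (1 - t) * e by rewrite ler_wpM2l ?subr_ge0// ltW.
lra.
Qed.

Lemma slope_convex (t : R) f g a b x : 0 <= t <= 1 -> Lip_b d f -> Lip_b d g ->
  slope f x <= a -> slope g x <= b ->
  slope (fun x => t * f x + (1 - t) * g x) x <= t * a + (1 - t) * b.
Proof.
move=> t01 bf bg fa gb; have /andP[t0 t1] := t01.
apply: (@le_trans _ _ (t * slope f x + (1 - t) * slope g x)).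
  have := lip_convex x t01 bf bg; have bfg := Lip_b_convex t01 bf bg.
  by rewrite -(slopeE x bfg) -(slopeE x bf) -(slopeE x bg) -lee_fin.
by rewrite lerD// ler_wpM2l// subr_ge0.
Qed.

Lemma strong_gradient_convex (t : R) f G H : 0 <= t <= 1 -> f \in L ->
  strong_gradient f G -> strong_gradient f H ->
  strong_gradient f (fun x => t * G x + (1 - t) * H x).
Proof.
move=> t01 fL [GL fG] [HL fH]; split; first exact: Lfun_convex.
move=> e e0; have [u [g [bu gL ug uf gG]]] := fG e e0.
have [v [h [bv hL vh vf hH]]] := fH e e0.
exists (fun x => t * u x + (1 - t) * v x), (fun x => t * g x + (1 - t) * h x).
have [uL vL] := (Lip_b_Lfun p1 bu, Lip_b_Lfun p1 bv).
split.
- exact: Lip_b_convex.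
- exact: Lfun_convex.
- by move=> x; exact: slope_convex.
- rewrite -(convex_same t f);
    apply: le_lt_trans (nrm_convex_dist t01 uL vL fL fL) _.
  exact: convex_lt.
- by apply: le_lt_trans (nrm_convex_dist t01 gL hL GL HL) _; exact: convex_lt.
Qed.

Lemma midpointE (f g : X -> R) :
  (fun x => 2^-1 * (f x + g x)) = (fun x => 2^-1 * f x + (1 - 2^-1) * g x).
Proof. by apply/funext => x; field. Qed.

Lemma half01 : 0 <= (2^-1 : R) <= 1. Proof. by apply/andP; split; lra. Qed.

(** Under these bounds the defect in [nrm_uniformly_convex] is nonpositive, so
    the distance between [f] and [g] is below any positive number. *)
Lemma eq_of_midpoint f g (c : R) : f \in L -> g \in L ->
  {ae m, forall x, 0 <= f x} -> {ae m, forall x, 0 <= g x} ->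
  nrm f `^ p <= c -> nrm g `^ p <= c ->
  c <= nrm (fun x => 2^-1 * (f x + g x)) `^ p -> f = g %[ae m].
Proof.
move=> fL gL f0 g0 fc gc cfg; apply: (nrm_dist_eq0 p1) => // e e0.
have c0 : 0 <= c by apply: le_trans fc; exact: powR_ge0.
have ep : 0 < e `^ p by exact: powR_gt0.
have [|C C0 /(_ f g fL gL f0 g0)] := @nrm_uniformly_convex _ _ _ m p p1
    (e `^ p / (2 * c + 1)).
  by rewrite divr_gt0//; lra.
set A := nrm f `^ p in fc *; set B := nrm g `^ p in gc *.
set M := nrm _ `^ p in cfg * => le_dist.
have leC : C * ((A + B) / 2 - M) <= 0 by rewrite mulr_ge0_le0//; lra.
have leE : e `^ p / (2 * c + 1) * (A + B) <= e `^ p.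
  rewrite mulrAC ler_pdivrMr; last by lra.
  by rewrite ler_wpM2l ?(ltW ep)//; lra.
have le_pow : nrm (f \- g) `^ p <= e `^ p by lra.
rewrite leNgt; apply/negP => lt_e.
have : e `^ p < nrm (f \- g) `^ p.
  by rewrite gt0_ltr_powR// ?nnegrE ?nrm_ge0// ltW.
by rewrite ltNge le_pow.
Qed.

Lemma strong_gradient_unique f G H : f \in L ->
  strong_gradient f G -> strong_gradient f H ->
  ((nrm G `^ p)%:E <= CE p f)%E -> ((nrm H `^ p)%:E <= CE p f)%E ->
  G = H %[ae m].
Proof.
move=> fL fG fH Gc Hc.
have CEG : CE p f = (nrm G `^ p)%:E.
  by apply/eqP; rewrite eq_le CE_strong_gradient.
apply: (@eq_of_midpoint _ _ (nrm G `^ p)) => //;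
  [exact: fG.1|exact: fH.1| | | |].
- exact: strong_gradient_ge0 fG.
- exact: strong_gradient_ge0 fH.
- by rewrite -lee_fin -CEG.
- rewrite -lee_fin -CEG midpointE; apply: CE_strong_gradient => //.
  by apply: strong_gradient_convex => //; exact: half01.
Qed.

Lemma strong_gradient_ae f G H : strong_gradient f G -> H \in L ->
  G = H %[ae m] -> strong_gradient f H.
Proof.
move=> [GL fG] HL GH; split=> // e e0; have [u [g [bu gL ug uf gG]]] := fG e e0.
exists u, g; split=> //; rewrite (_ : nrm _ = nrm (g \- G))//.
apply: ae_eq_nrm => //; [exact: LfunB|exact: LfunB|].
by apply: ae_mono GH => x /(_ I) /= ->.
Qed.

End relaxed_gradients.

(** The arithmetic of the Cauchy estimate below: [A] and [B] are the energies of
    two approximations, [M] that of their midpoint, [c] the infimum, and [h] an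
    excess energy small enough for the defect term, with its constant [C], to
    stay below half of the target [E]. *)
Lemma defect_bound (R : realType) (E C c A B M h : R) :
  0 < E -> 0 <= C -> 0 <= c -> h = E / (4 * (C + 1)) -> 0 <= A -> 0 <= B ->
  A < c + h -> B < c + h -> A < c + 1 -> B < c + 1 -> c - h <= M ->
  E / (2 * (2 * c + 2)) * (A + B) + C * ((A + B) / 2 - M) <= E.
Proof.
move=> E0 C0 c0 hE A0 B0 Ah Bh A1 B1 hM.
have leC : C * ((A + B) / 2 - M) <= C * (2 * h) by rewrite ler_wpM2l//; lra.
have leh : C * (2 * h) <= E / 2.
  rewrite hE; have -> : C * (2 * (E / (4 * (C + 1)))) = E / 2 * (C / (C + 1)).
    by field; lra.
  by rewrite ler_piMr ?divr_ge0 ?(ltW E0)// ler_pdivrMr; lra.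
have lec : E / (2 * (2 * c + 2)) * (A + B) <= E / 2.
  have -> : E / (2 * (2 * c + 2)) * (A + B) = E / 2 * ((A + B) / (2 * c + 2)).
    by field; lra.
  by rewrite ler_piMr ?divr_ge0 ?(ltW E0)// ler_pdivrMr; lra.
lra.
Qed.

Section minimal_gradients.
Context {R : realType} (X : emtmSpace R) (p : R) (p1 : 1 < p).
Local Notation d := (@emdist R X).
Local Notation m := (@emeas R X).
Local Notation L := (Lfun m p%:E).
Local Notation nrm := (nrm m p).
Implicit Types (f g u : X -> R) (G H : Lpfun X p1).
Let p0 : 0 < p. Proof. exact: lt_trans p1. Qed.

Lemma Lpfun_Lfun G : (G : X -> R) \in L.
Proof. exact: LfunP. Qed.

Lemma energy_lsc f (c : R) : f \in L -> CE p f = c%:E -> forall e : R, 0 < e ->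
  exists2 r : R, 0 < r & forall u, Lip_b d u -> nrm (u \- f) < r ->
    c - e <= nrm (slope u) `^ p.
Proof.
move=> fL CEf e e0; apply: contrapT => nr.
have : (CE p f <= (c - e)%:E)%E.
  apply: CE_le => // r r0; apply: contrapT => nu; apply: nr;
    exists r => // u bu ur.
  rewrite leNgt; apply/negP => lt_u; apply: nu; exists u; split=> //;
    first exact: ltW.
  by rewrite lee_fin ltW.
by rewrite CEf lee_fin; move: e0; lra.
Qed.

(** The midpoint of two slopes dominates the slope of the midpoint of the two
    approximations, whose energy is at least almost the infimum [c]. So the
    defect of the energy at the midpoint is small, and uniform convexity bounds
    the distance between the slopes. *)
Lemma minimizing_slopes_cauchy f (c : R) (u : nat -> X -> R) : f \in L ->
  CE p f = c%:E -> (forall n, Lip_b d (u n)) ->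
  (forall n, nrm (u n \- f) < n.+1%:R^-1) ->
  (forall n, nrm (slope (u n)) `^ p < c + n.+1%:R^-1) ->
  forall e : R, 0 < e -> exists N, forall n k, (N <= n)%N -> (N <= k)%N ->
    nrm (slope (u n) \- slope (u k)) <= e.
Proof.
move=> fL CEf bu uf uc e e0.
have c0 : 0 <= c by rewrite -lee_fin -CEf CE_ge0.
have ep : 0 < e `^ p by exact: powR_gt0.
have r0 : 0 < e `^ p / (2 * (2 * c + 2)) by rewrite divr_gt0//; lra.
have [C C0 CP] := @nrm_uniformly_convex _ _ _ m p p1 _ r0.
set r := e `^ p / _ in r0 CP.
pose h := e `^ p / (4 * (C + 1)).
have h0 : 0 < h by rewrite divr_gt0//; lra.
have [s s0 low] := energy_lsc fL CEf h0.
have [N Nsmall] : exists N : nat, forall n, (N <= n)%N ->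
    n.+1%:R^-1 < Num.min (Num.min s h) 1 :> R.
  have : n.+1%:R^-1 @[n --> \oo] --> (0 : R) by exact: cvg_harmonic.
  move=> /cvgrPdist_lt /(_ (Num.min (Num.min s h) 1)).
  rewrite !lt_min s0 h0 ltr01 => /(_ isT)[N _ Nsmall]; exists N => n /Nsmall.
  by rewrite /= sub0r normrN ger0_norm.
exists N => n k /Nsmall + /Nsmall; rewrite !lt_min.
set a := n.+1%:R^-1; set b := k.+1%:R^-1 =>
  /andP[/andP[as_ ah] a1] /andP[/andP[bs bh] b1].
have [gnL gkL] := (slope_Lfun p1 (bu n), slope_Lfun p1 (bu k)).
have [unL ukL] := (Lip_b_Lfun p1 (bu n), Lip_b_Lfun p1 (bu k)).
pose v := fun x => 2^-1 * (u n x + u k x).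
have bv : Lip_b d v by rewrite /v midpointE; apply: Lip_b_convex => //;
  exact: half01.
have vf : nrm (v \- f) < s.
  rewrite /v midpointE -(convex_same 2^-1 f).
  apply: le_lt_trans (nrm_convex_dist p1 (@half01 R) unL ukL fL fL) _.
  by apply: convex_lt; [exact: half01|exact: lt_trans as_|exact: lt_trans bs].
have vc := low v bv vf.
have mid : nrm (slope v) `^ p <=
    nrm (fun x => 2^-1 * (slope (u n) x + slope (u k) x)) `^ p.
  rewrite ge0_ler_powR ?(ltW p0)// ?nnegrE ?nrm_ge0//.
  apply: ae_le_nrm => //; first exact: slope_Lfun.
    by rewrite midpointE; exact: Lfun_convex.
  apply: aeW => x; rewrite ger0_norm ?slope_ge0// ger0_norm; last first.
    by rewrite mulr_ge0// addr_ge0 ?slope_ge0.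
  have -> : 2^-1 * (slope (u n) x + slope (u k) x) =
    2^-1 * slope (u n) x + (1 - 2^-1) * slope (u k) x by field.
  by rewrite /v midpointE; apply: slope_convex => //; exact: half01.
have := CP _ _ gnL gkL (slope_ae_ge0 (u n)) (slope_ae_ge0 (u k)).
have := uc n; have := uc k; rewrite -/a -/b.
set A := nrm (slope (u n)) `^ p; set B := nrm (slope (u k)) `^ p.
have := mid; have := vc; set V := nrm (slope v) `^ p.
set M := nrm (fun x => 2^-1 * (slope (u n) x + slope (u k) x)) `^ p => Vc MV.
move=> Bc Ac le_dist.
have le_sum : r * (A + B) + C * ((A + B) / 2 - M) <= e `^ p.
  have A0 : 0 <= A by exact: powR_ge0.
  have B0 : 0 <= B by exact: powR_ge0.
  have [Ah A1] : A < c + h /\ A < c + 1 by split; apply: lt_trans Ac _;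
    rewrite ltrD2l.
  have [Bh B1] : B < c + h /\ B < c + 1 by split; apply: lt_trans Bc _;
    rewrite ltrD2l.
  exact: (defect_bound ep C0 c0 erefl A0 B0 Ah Bh A1 B1 (le_trans Vc MV)).
have le_pow : nrm (slope (u n) \- slope (u k)) `^ p <= e `^ p by lra.
rewrite leNgt; apply/negP => lt_e.
have : e `^ p < nrm (slope (u n) \- slope (u k)) `^ p.
  by rewrite gt0_ltr_powR// ?nnegrE ?nrm_ge0// ltW.
by rewrite ltNge le_pow.
Qed.

Lemma cvg_nrm (g : nat -> X -> R) G : (forall n, g n \in L) ->
  nrm (g n \- G) @[n --> \oo] --> (0 : R) -> nrm (g n) @[n --> \oo] --> nrm G.
Proof.
move=> gL gG; apply/cvgrPdist_le => e e0.
move/cvgrPdist_le : gG => /(_ e e0); apply: filterS => n.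
rewrite sub0r normrN ger0_norm ?nrm_ge0// => gGn; apply: le_trans gGn.
have := le_nrm_dist p1 (gL n) (Lpfun_Lfun G).
have := le_nrm_dist p1 (Lpfun_Lfun G) (gL n).
by rewrite [nrm (G \- _)]nrmBC ler_norml; lra.
Qed.

(** The slopes of a minimizing sequence converge strongly, and their limit
    attains the infimum. *)
Lemma relaxed_gradient_exists f (c : R) : f \in L -> CE p f = c%:E ->
  exists G, [/\ relaxed_gradient f G, strong_gradient p f G & nrm G `^ p <= c].
Proof.
move=> fL CEf.
have /choice[u uP] (n : nat) : exists u, [/\ Lip_b d u, nrm (u \- f) <
  n.+1%:R^-1 &
    nrm (slope u) `^ p < c + n.+1%:R^-1].
  have CElt : (CE p f < (c + n.+1%:R^-1)%:E)%E by rewrite CEf lte_fin ltrDl.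
  by have [|v [? ? ?]] := CE_lt p1 fL CElt (e := n.+1%:R^-1); [|exists v].
have bu n : Lip_b d (u n) by case: (uP n).
have uf n : nrm (u n \- f) < n.+1%:R^-1 by case: (uP n).
have uc n : nrm (slope (u n)) `^ p < c + n.+1%:R^-1 by case: (uP n).
have sL n : slope (u n) \in L by exact: slope_Lfun.
have [G0 G0L sG] := Lp_complete p1 sL (minimizing_slopes_cauchy fL CEf bu uf
  uc).
pose G : Lpfun X p1 := Lfun_Sub (gt1_EFin_ge1 p1) G0L.
pose g n : Lpfun X p1 := Lfun_Sub (gt1_EFin_ge1 p1) (sL n).
have gG : nrm (g n \- G) @[n --> \oo] --> (0 : R).
  apply/cvgrPdist_le => e e0; have [N NP] := sG e e0; exists N => // n /NP.
  by rewrite sub0r normrN ger0_norm ?nrm_ge0.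
have uf0 : nrm (u n \- f) @[n --> \oo] --> (0 : R).
  apply: (@squeeze_cvgr _ _ _ _ (cst 0) (fun n => n.+1%:R^-1)).
  - by apply: nearW => n; rewrite nrm_ge0 ltW.
  - exact: cvg_cst.
  - exact: cvg_harmonic.
exists G; split.
- exists u, g, G; split=> //.
  + exact/(cvg_LpP p1 bu fL).
  + by move=> n x; rewrite -slopeE.
  + move=> phi [C phiC]; apply/cvgrPdist_le => e e0.
    have C0 : 0 < `|C| + 1 by rewrite ltr_wpDl.
    have := gG; move=> /cvgrPdist_le /(_ (e / (`|C| + 1))).
    rewrite divr_gt0// => /(_ isT); apply: filterS => n.
    rewrite sub0r normrN ger0_norm ?nrm_ge0// nrmBC ler_pdivlMr// => le_e.
    rewrite -linearB; apply: le_trans le_e; have := phiC (G - g n).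
    rewrite nrmE ?Lpfun_Lfun// -EFinM lee_fin => /le_trans; apply.
    rewrite mulrC ler_wpM2l ?nrm_ge0//.
    by rewrite ler_wpDr// ler_norm.
  + exact: aeW.
- split; first exact: Lpfun_Lfun.
  move=> e e0; move/cvgrPdist_lt : gG => /(_ e e0) gG.
  move/cvgrPdist_lt : uf0 => /(_ e e0) uf0.
  have [n [un gn]] := filter_ex (filterI uf0 gG).
  move: un gn; rewrite /= !sub0r !normrN !ger0_norm ?nrm_ge0// => un gn.
  by exists (u n), (slope (u n)).
- have := cvg_powR p1 (fun n => nrm_ge0 m p _) (cvg_nrm sL gG).
  move=> /ler_cvg_to; apply; last by apply: nearW => n; exact: ltW (uc n).
  by rewrite -[X in _ --> X]addr0; apply: cvgD;
    [exact: cvg_cst|exact: cvg_harmonic].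
Qed.

(** Mazur's lemma upgrades the weak convergence of the slopes to strong
    convergence of majorants of slopes. *)
Lemma relaxed_strong_gradient f G : f \in L -> relaxed_gradient f G ->
  exists2 H, strong_gradient p f H & {ae m, forall x, H x <= G x}.
Proof.
move=> fL [u [g [H [bu uf gu gH HG]]]]; exists H => //.
split; first exact: Lpfun_Lfun.
move=> e e0.
pose q (h : Lpfun X p1) := nrm h.
pose C : set (Lpfun X p1) := [set h | exists u, [/\ Lip_b d u,
  forall x, slope u x <= h x & nrm (u \- f) < e]].
have sq : sublinear q.
  split=> [h k|a h a0].
    exact: (nrmD p1 (Lpfun_Lfun h) (Lpfun_Lfun k)).
  by have := nrmZ p1 a (Lpfun_Lfun h); rewrite ger0_norm ?(ltW a0)// => <-.
have qN h : q (- h) = q h.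
  have := nrmZ p1 (-1) (Lpfun_Lfun h); rewrite normrN1 mul1r /q => <-.
  by congr nrm; apply/funext => x; rewrite mulN1r.
have /cvgrPdist_lt/(_ e e0)[N _ uN] := (cvg_LpP p1 bu fL).1 uf.
have [|n|phi phiq|h [v [bv vh vf]] hH] := mazur sq qN (C := C)
    (g := fun n => g (n + N)%N) (H := H) _ _ _ e0.
- move=> h k t t01 [v [bv vh vf]] [w [bw wk wf]].
  exists (fun x => t * v x + (1 - t) * w x); split.
  + exact: Lip_b_convex.
  + by move=> x; exact: slope_convex.
  + have [vL wL] := (Lip_b_Lfun p1 bv, Lip_b_Lfun p1 bw).
    rewrite -(convex_same t f).
    by apply: le_lt_trans (nrm_convex_dist p1 t01 vL wL fL fL) _;
      exact: convex_lt.
- exists (u (n + N)%N); split=> //.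
    by move=> x; rewrite -lee_fin slopeE// gu.
  by have := uN (n + N)%N (leq_addl _ _);
    rewrite /= sub0r normrN ger0_norm ?nrm_ge0.
- rewrite (cvg_shiftn N (fun n => phi (g n)) _).
  apply: gH; exists 1 => h; rewrite mul1e nrmE ?Lpfun_Lfun// lee_fin;
    exact: phiq.
exists v, h; split=> //; first exact: Lpfun_Lfun.
by rewrite nrmBC.
Qed.

Lemma relaxed_gradient_norm_ge f (c : R) G : f \in L -> CE p f = c%:E ->
  relaxed_gradient f G -> c <= nrm G `^ p.
Proof.
move=> fL CEf /(relaxed_strong_gradient fL)[H fH HG].
have := CE_strong_gradient p1 fL fH; rewrite CEf lee_fin => /le_trans; apply.
rewrite ge0_ler_powR ?(ltW p0)// ?nnegrE ?nrm_ge0//.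
apply: (ae_le_nrm p1 fH.1 (Lpfun_Lfun G)).
apply: ae_mono2 HG (strong_gradient_ge0 p1 fH) => x HG H0.
by rewrite !ger0_norm// (le_trans H0).
Qed.

Lemma minimal_relaxed_gradient_exists f : f \in L -> (CE p f < +oo)%E ->
  @minimal_relaxed_gradient R X p p1 f !=set0.
Proof.
move=> fL CEfin; have CEf : CE p f = (fine (CE p f))%:E.
  by rewrite fineK// ge0_fin_numE// CE_ge0.
have [G [fG _ Gc]] := relaxed_gradient_exists fL CEf.
exists G; split=> // G' fG'; rewrite !nrmE ?Lpfun_Lfun// lee_fin leNgt.
apply/negP => lt_G; have : nrm G' `^ p < nrm G `^ p.
  by rewrite gt0_ltr_powR// ?nnegrE ?nrm_ge0.
rewrite ltNge (le_trans Gc)//; exact: relaxed_gradient_norm_ge fG'.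
Qed.

Lemma minimal_relaxed_gradientP f G : f \in L -> (CE p f < +oo)%E ->
  @minimal_relaxed_gradient R X p p1 f G ->
  strong_gradient p f G /\ (nrm G `^ p)%:E = CE p f.
Proof.
move=> fL CEfin [fG Gmin]; have CEf : CE p f = (fine (CE p f))%:E.
  by rewrite fineK// ge0_fin_numE// CE_ge0.
set c := fine (CE p f) in CEf.
have [G0 [fG0 _ G0c]] := relaxed_gradient_exists fL CEf.
have Gc : nrm G `^ p = c.
  apply/eqP; rewrite eq_le (relaxed_gradient_norm_ge fL CEf fG) andbT.
  apply: le_trans G0c; rewrite ge0_ler_powR ?(ltW p0)// ?nnegrE ?nrm_ge0//.
  by have := Gmin _ fG0; rewrite !nrmE ?Lpfun_Lfun// lee_fin.
split; last by rewrite Gc.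
have [H fH HG] := relaxed_strong_gradient fL fG.
have H0 := strong_gradient_ge0 p1 fH.
have Gge0 : {ae m, forall x, 0 <= G x}.
  by apply: ae_mono2 HG H0 => x HG H0; exact: le_trans HG.
apply: (strong_gradient_ae p1 fH); first exact: Lpfun_Lfun.
have [HL GL] := (fH.1, Lpfun_Lfun G).
have cH : c <= nrm H `^ p by have := CE_strong_gradient p1 fL fH;
  rewrite CEf lee_fin.
have midL : (fun x => 2^-1 * (H x + G x)) \in L by rewrite midpointE;
  exact: Lfun_convex.
apply: (@eq_of_midpoint _ _ p p1 H G c) => //; last 2 first.
- by rewrite Gc.
- apply: le_trans cH _; rewrite ge0_ler_powR ?(ltW p0)// ?nnegrE ?nrm_ge0//.
  apply: ae_le_nrm => //; apply: ae_mono2 HG H0 => x HG H0.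
  have Gx0 := le_trans H0 HG.
  rewrite (ger0_norm H0) ger0_norm ?mulr_ge0 ?addr_ge0//.
  by rewrite ler_pdivlMl// mulr_natl mulr2n lerD2l.
rewrite -Gc ge0_ler_powR ?(ltW p0)// ?nnegrE ?nrm_ge0//.
apply: ae_le_nrm => //; apply: ae_mono2 HG H0 => x HG H0.
by rewrite !ger0_norm// (le_trans H0).
Qed.

End minimal_gradients.

(** * Continuous semidistances below the extended distance *)

(** The tails of an upward directed family form a filter base, and compactness
    applied to this filter replaces the choice of a finite subcover. *)
Lemma directed_compact (T : topologicalType) (I : Type) (i0 : I) (C : set T)
    (P : I -> set T) : compact C ->
  (forall i j, exists k, P i `|` P j `<=` P k) ->
  (forall x, C x -> exists i, \forall y \near x, C y -> P i y) ->
  exists i, C `<=` P i.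
Proof.
move=> /compact_near_coveringP/near_covering_withinP cC dirP CP.
pose F := filter_from [set: I] (fun i => [set j | P i `<=` P j]).
have FF : Filter F.
  apply: filter_from_filter; first by exists i0.
  move=> i j _ _; have [k ijk] := dirP i j; exists k => // l /= kl.
  by split=> x Px; apply/kl/ijk; [left|right].
have [|i _ iC] := cC I F P FF; last by exists i; exact: iC.
move=> x Cx; have [i iP] := CP x Cx.
exists ([set y | C y -> P i y], [set j | P i `<=` P j]); first by split=> //;
  exists i.
by move=> [y j] [/= yP ij] Cy; apply/ij/yP.
Qed.

Section semidistances.
Context {R : realType} (Y : emtmSpace R).
Local Notation d := (@emdist R Y).
Implicit Types (D E : Y -> Y -> R) (g : Y -> R).

(** The topology of [Y] is generated by such [D]; unlike [d] they are finite
    and continuous, so that McShane extensions built from them are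
    continuous. *)
Record semidistance D : Prop := {
  semi_refl : forall x, D x x = 0 ;
  semi_sym : forall x y, D x y = D y x ;
  semi_triangle : forall x y z, D x z <= D x y + D y z ;
  semi_continuous : forall x, continuous (D x) ;
  semi_le : forall x y, ((D x y)%:E <= d x y)%E }.

Lemma semi_ge0 D x y : semidistance D -> 0 <= D x y.
Proof.
move=> sD; have := semi_triangle sD x y x.
by rewrite (semi_refl sD) (semi_sym sD y x); lra.
Qed.

Lemma semidistance0 : semidistance (fun _ _ => 0).
Proof.
split=> [//|//|x y z|x|x y].
- by rewrite addr0.
- exact: cst_continuous.
- exact: emdist_ge0.
Qed.

Lemma semidistance_max D E : semidistance D -> semidistance E ->
  semidistance (fun x y => Num.max (D x y) (E x y)).
Proof.
move=> [D0 DC DT Dc Dd] [E0 EC ET Ec Ed]; split=> [x|x y|x y z|x|x y].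
- by rewrite D0 E0 maxxx.
- by rewrite DC EC.
- rewrite ge_max; apply/andP; split.
    by apply: le_trans (DT x y z) _; apply: lerD; rewrite le_max lexx.
  by apply: le_trans (ET x y z) _; apply: lerD; rewrite le_max lexx orbT.
- by move=> y; apply: continuous_max; [exact: Dc|exact: Ec].
- by rewrite EFin_max ge_max Dd Ed.
Qed.

Lemma semidistance_Lip_b1 g : Lip_b1 d g -> semidistance (fun x y =>
  `|g x - g y|).
Proof.
move=> [[cg _ _] g1]; split=> [x|x y|x y z|x y|x y].
- by rewrite subrr normr0.
- by rewrite distrC.
- by rewrite -(subrKA (g y)) ler_normD.
- by apply: cvg_norm; apply: cvgB; [exact: cvg_cst|exact: cg].
- have g1e (e : R) : 0 < e -> (`|g x - g y|%:E <= (1 + e)%:E * d x y)%E.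
    move=> e0; apply: (Lip_lt (@emdist_ge0 _ Y) (A := setT)) => //.
    apply: le_lt_trans g1 _; rewrite lte_fin ltrDl; exact: e0.
  have := emdist_ge0 x y; case: (d x y) g1e => [r g1e r0| |//];
    last by move=> *; rewrite leey.
  rewrite lee_fin; apply/ler_addgt0Pr => e e0.
  have r1 : 0 < r + 1 by rewrite lee_fin in r0; lra.
  have := g1e (e / (r + 1)); rewrite divr_gt0// lee_fin => /(_ isT) /le_trans;
    apply.
  rewrite mulrDl mul1r lerD2l mulrAC ler_pdivrMr// ler_pM2l//; lra.
Qed.

Lemma semidistance_approx x y (r : R) : (r%:E < d x y)%E ->
  exists2 D, semidistance D & r < D x y.
Proof.
rewrite (emt_dist_sup (emtm_emt Y)) => /ereal_sup_gt[_ [g g1 <-]].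
rewrite lte_fin => rg; exists (fun x y => `|g x - g y|) => //.
exact: semidistance_Lip_b1.
Qed.

Lemma semi_dist_le D x y x' y' : semidistance D ->
  `|D x y - D x' y'| <= D x x' + D y y'.
Proof.
move=> sD; rewrite ler_norml; apply/andP; split.
  have := semi_triangle sD x' x y'; have := semi_triangle sD x y y'.
  by rewrite (semi_sym sD x' x); lra.
have := semi_triangle sD x x' y; have := semi_triangle sD x' y' y.
by rewrite (semi_sym sD y' y); lra.
Qed.

Lemma semi_near D x (e : R) : semidistance D -> 0 < e ->
  \forall y \near x, D x y < e.
Proof.
move=> sD e0; have := @semi_continuous D sD x x.
move=> /cvgrPdist_lt/(_ e e0); apply: filterS => y.
by rewrite (semi_refl sD) sub0r normrN ger0_norm// semi_ge0.
Qed.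

End semidistances.

(** * Extension from compact sets *)

Lemma near_prod (T U : topologicalType) (x : T) (y : U) (A : set T)
    (B : set U) :
  (\forall x' \near x, A x') -> (\forall y' \near y, B y') ->
  \forall z \near (x, y), A z.1 /\ B z.2.
Proof. by move=> xA yB; exists (A, B). Qed.

Section embedding_compactness.
Context {R : realType} (X X' : emtmSpace R) (iota : X -> X').
Hypothesis emb : measure_preserving_embedding iota.
Local Notation d := (@emdist R X).
Local Notation d' := (@emdist R X').

Lemma embedding_near (D : X' -> X' -> R) (x : X) (e : R) : semidistance D ->
  0 < e ->
  \forall y \near x, D (iota x) (iota y) < e.
Proof.
move=> sD e0; move: (semi_near (iota x) sD e0).
exact: (@mpe_continuous _ _ _ _ emb x).
Qed.

(** Semidistances are directed upwards by [semidistance_max], so a monotone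
    property of pairs that each pair acquires, with its neighbours, for some
    semidistance is acquired by all pairs of a compact set at once. *)
Lemma compact_semidistance (K : set X)
    (P : (X' -> X' -> R) -> nat -> X -> X -> Prop) : compact K ->
  (forall D E n k x y, semidistance E -> (forall z w, D z w <= E z w) ->
     (n <= k)%N -> P D n x y -> P E k x y) ->
  (forall x y, K x -> K y -> exists D n, semidistance D /\
     \forall z \near (x, y), K z.1 -> K z.2 -> P D n z.1 z.2) ->
  exists D n, semidistance D /\ forall x y, K x -> K y -> P D n x y.
Proof.
move=> cK Pmono Ploc.
pose I := ({D : X' -> X' -> R | semidistance D} * nat)%type.
pose i0 : I := (exist _ _ (@semidistance0 _ X'), 0%N).
pose Q (i : I) : set (X * X) := [set z | P (sval i.1) i.2 z.1 z.2].
have [| |[[D sD] n] /= DP] :=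
    directed_compact i0 (P := Q) (compact_setX cK cK).
- move=> [[D sD] n] [[E sE] k].
  exists (exist _ _ (semidistance_max sD sE), maxn n k) => z [] /=.
    apply: Pmono => [|x y|]; first exact: semidistance_max.
      by rewrite le_max lexx.
    exact: leq_maxl.
  apply: Pmono => [|x y|]; first exact: semidistance_max.
    by rewrite le_max lexx orbT.
  exact: leq_maxr.
- move=> [x y] [/= Kx Ky]; have [D [n [sD nearP]]] := Ploc x y Kx Ky.
  by exists (exist _ D sD, n); apply: filterS nearP => z zP [Kz1 Kz2];
    exact: zP.
by exists D, n; split=> // x y Kx Ky; exact: (DP (x, y)).
Qed.

(** Distinct points are separated by some semidistance. Compactness makes the
    separation of the pieces uniform, with the lower bound [1 / n]. *)
Lemma compact_label_separation (K : set X) (lab : X -> nat) : compact K ->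
  (forall x, K x -> \forall y \near x, K y -> lab y = lab x) ->
  exists D n, semidistance D /\ forall x y, K x -> K y -> lab x != lab y ->
    1 <= n%:R * D (iota x) (iota y).
Proof.
move=> cK labK.
apply: (@compact_semidistance K (fun D n x y => lab x != lab y ->
  1 <= n%:R * D (iota x) (iota y)) cK).
  move=> D E n k x y sE DE nk DP /DP /le_trans; apply.
  apply: (@le_trans _ _ (n%:R * E (iota x) (iota y)));
    first by rewrite ler_wpM2l.
  by rewrite ler_wpM2r ?ler_nat// semi_ge0.
move=> x y Kx Ky; have [lxy|lxy] := eqVneq (lab x) (lab y).
  exists (fun _ _ => 0), 0%N; split; first exact: semidistance0.
  apply: filterS (near_prod (labK x Kx) (labK y Ky)) => z [zx zy] Kz1 Kz2.
  by rewrite zx// zy// lxy eqxx.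
have dxy : (0%:E < d x y)%E.
  rewrite lt_def emdist_ge0 andbT;
    apply/eqP => /(edist_eq0 (emt_edist (emtm_emt X))).
  by move=> xy; rewrite xy eqxx in lxy.
have [D sD D0] : exists2 D, semidistance D & 0 < D (iota x) (iota y).
  by apply: semidistance_approx; rewrite (mpe_isometry emb).
set r := D (iota x) (iota y) in D0.
have [n rn] : exists n : nat, 2 / r <= n%:R.
  exists (Num.bound (2 / r)); apply/ltW/archi_boundP.
  by rewrite divr_ge0// ltW.
exists D, n; split=> //.
have r4 : 0 < r / 4 by rewrite divr_gt0.
apply: filterS (near_prod (embedding_near x sD r4) (embedding_near y sD r4)).
move=> z [zx zy] Kz1 Kz2 _.
have := semi_dist_le (iota x) (iota y) (iota z.1) (iota z.2) sD;
  rewrite -/r => rz.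
have rD : r / 2 <= D (iota z.1) (iota z.2).
  by move: rz; rewrite ler_norml; lra.
apply: (@le_trans _ _ (n%:R * (r / 2))); last by rewrite ler_wpM2l.
by move: rn; rewrite ler_pdivrMr//; lra.
Qed.

(** Since [d] is a supremum of semidistances, each pair of points satisfies the
    estimate, with the error [eta] to spare, for some semidistance. Continuity
    extends it to nearby pairs and compactness to all pairs. *)
Lemma compact_label_lipschitz (K : set X) (lab : X -> nat) (c : nat -> nat -> R)
    (f : X -> R) (eta : R) : compact K -> continuous f ->
  (forall x, K x -> \forall y \near x, K y -> lab y = lab x) ->
  (forall x y, K x -> K y -> 0 <= c (lab x) (lab y)) ->
  (forall x y, K x -> K y ->
     (`|f x - f y|%:E <= (c (lab x) (lab y))%:E * d x y)%E) ->
  0 < eta ->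
  exists2 D, semidistance D & forall x y, K x -> K y ->
    `|f x - f y| <= c (lab x) (lab y) * D (iota x) (iota y) + eta.
Proof.
move=> cK cf labK c0 fc eta0.
suff [D [n [sD DP]]] : exists D (n : nat), semidistance D /\ forall x y, K x ->
  K y ->
    (K x /\ K y -> `|f x - f y| <= c (lab x) (lab y) * D (iota x) (iota y) +
      eta).
  by exists D => // x y Kx Ky; exact: DP.
apply: (@compact_semidistance K (fun D n x y => K x /\ K y -> `|f x - f y| <=
  c (lab x) (lab y) * D (iota x) (iota y) + eta) cK).
  move=> D E _ _ x y _ DE _ DP Kxy; apply: le_trans (DP Kxy) _.
  by rewrite lerD2r ler_wpM2l// c0; case: Kxy.
move=> x y Kx Ky; set a := c (lab x) (lab y).
have a0 : 0 <= a by exact: c0.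
have [D sD fD] : exists2 D, semidistance D &
    `|f x - f y| < a * D (iota x) (iota y) + eta.
  have := fc x y Kx Ky; rewrite -/a.
  have [->|an0] := eqVneq a 0.
    rewrite mul0e lee_fin => fxy; exists (fun _ _ => 0);
      first exact: semidistance0.
    by rewrite mul0r add0r; exact: le_lt_trans fxy eta0.
  have apos : 0 < a by rewrite lt_def an0.
  move=> fxy; have [D sD DP] : exists2 D, semidistance D &
      (`|f x - f y| - eta) / a < D (iota x) (iota y).
    apply: semidistance_approx; rewrite (mpe_isometry emb).
    move: fxy; have := emdist_ge0 x y.
    case: (d x y) => [r r0 fr| |//]; last by move=> *; exact: ltry.
    rewrite lte_fin ltr_pdivrMr//; move: fr; rewrite -EFinM lee_fin => fr.
    by rewrite mulrC; lra.
  exists D => //; move: DP; rewrite ltr_pdivrMr// mulrC; lra.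
exists D, 0%N; split=> //.
set r := D (iota x) (iota y) in fD.
pose t := (a * r + eta - `|f x - f y|) / (2 * a + 2).
have t0 : 0 < t by rewrite divr_gt0//; lra.
have tE : 2 * t + 2 * a * t = a * r + eta - `|f x - f y|.
  by rewrite /t; field; lra.
have fnear w : \forall z \near w, `|f w - f z| < t.
  by have /cvgrPdist_lt/(_ t t0) := cf w.
have near_at w : K w -> \forall z \near w,
    [/\ K z -> lab z = lab w, `|f w - f z| < t & D (iota w) (iota z) < t].
  by move=> Kw; apply: filterS3 (labK w Kw) (fnear w) (embedding_near w sD t0).
apply: filterS (near_prod (near_at x Kx) (near_at y Ky)).
move=> z [[zx fx Dx] [zy fy Dy]] Kz1 Kz2 _.
rewrite zx// zy// -/a.
have := semi_dist_le (iota x) (iota y) (iota z.1) (iota z.2) sD;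
  rewrite -/r => rz.
have aD : a * (r - 2 * t) <= a * D (iota z.1) (iota z.2).
  by rewrite ler_wpM2l//; move: rz; rewrite ler_norml; lra.
have : `|f z.1 - f z.2| <= `|f x - f y| + 2 * t.
  rewrite (_ : f z.1 - f z.2 = (f x - f y) - ((f x - f z.1) - (f y - f z.2)));
    last by ring.
  apply: le_trans (ler_normB _ _) _; rewrite lerD2l.
  apply: le_trans (ler_normB _ _) _; lra.
lra.
Qed.

End embedding_compactness.

Section clamp.
Context {R : realType} (M : R).
Hypothesis M0 : 0 <= M.

Definition clamp (x : R) : R := Num.max (- M) (Num.min M x).

Lemma clamp_le x : `|clamp x| <= M.
Proof.
rewrite /clamp ler_norml le_max lexx /= ge_max ge_min lexx /= andbT.
by move: M0; lra.
Qed.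

Lemma clamp_id x : `|x| <= M -> clamp x = x.
Proof.
by rewrite ler_norml /clamp => /andP[Mx xM]; rewrite min_r// max_r.
Qed.

Lemma clamp_lipschitz x y : `|clamp x - clamp y| <= `|x - y|.
Proof.
wlog xy : x y / x <= y.
  move=> W; have [|/ltW] := leP x y; first exact: W.
  by rewrite distrC (distrC x); exact: W.
rewrite distrC (distrC x) (@ger0_norm _ (y - x)) ?subr_ge0// ler_norml /clamp.
by rewrite /Num.max /Num.min; repeat case: ifPn; rewrite -?leNgt; lra.
Qed.

End clamp.

Lemma le_inf_shift (R : realType) (A B : set R) (c : R) : A !=set0 ->
  has_lbound B -> (forall s, A s -> exists2 t, B t & t <= s + c) ->
  inf B <= inf A + c.
Proof.
move=> A0 lB AB; rewrite -lerBlDr; apply: lb_le_inf => // s /AB[t Bt ts].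
by rewrite lerBlDr; apply: le_trans ts; exact: ge_inf.
Qed.

Section semidistance_lipschitz.
Context {R : realType} (Y : emtmSpace R) (D : Y -> Y ->
  R) (sD : semidistance D).
Variables (a : R) (v : Y -> R).

Lemma semi_lipschitz_on (U : set Y) : 0 <= a ->
  (forall z w, U z -> U w -> `|v z - v w| <= a * D z w) ->
  lipschitz_on (@emdist R Y) a v U.
Proof.
move=> a0 vD z w Uz Uw; apply: (@le_trans _ _ (a * D z w)%:E).
  by rewrite lee_fin vD.
by rewrite EFinM lee_wpmul2l ?lee_fin//; exact: semi_le.
Qed.

Lemma semi_lipschitz_continuous : 0 <= a ->
  (forall z w, `|v z - v w| <= a * D z w) -> continuous v.
Proof.
move=> a0 vD z; apply/cvgrPdist_lt => e e0.
have a1 : 0 < a + 1 by lra.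
have := semi_near z sD (divr_gt0 e0 a1); apply: filterS => w zw.
apply: le_lt_trans (vD z w) _; apply: (@le_lt_trans _ _ ((a + 1) * D z w)).
  by rewrite ler_wpM2r ?semi_ge0// lerDl.
by rewrite mulrC -ltr_pdivlMr.
Qed.

End semidistance_lipschitz.

Section extension.
Context {R : realType} (X X' : emtmSpace R) (iota : X -> X').
Hypothesis emb : measure_preserving_embedding iota.
Local Notation d := (@emdist R X).
Local Notation d' := (@emdist R X').
Variables (K : set X) (lab : X -> nat) (a : nat -> R) (f : X -> R) (M L : R).
Variables (D : X' -> X' -> R) (eta theta kappa : R).
Hypothesis sD : semidistance D.
Hypotheses (K0 : K !=set0) (L0 : 0 <= L) (eta0 : 0 <= eta) (theta0 : 0 < theta).
Hypothesis fM : forall x, `|f x| <= M.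
Hypothesis aL : forall x, K x -> 0 <= a (lab x) <= L + 1.
Hypothesis f_same : forall x y, K x -> K y -> lab x = lab y ->
  `|f x - f y| <= a (lab x) * D (iota x) (iota y) + eta.
Hypothesis f_diff : forall x y, K x -> K y ->
  `|f x - f y| <= L * D (iota x) (iota y) + eta.
Hypothesis separated : forall x y, K x -> K y -> lab x <> lab y ->
  kappa <= D (iota x) (iota y).
Hypothesis small : 2 * eta + 4 * (L + 1) * theta <= kappa.

Definition near_piece (i : nat) (q : X') :=
  exists2 x, K x /\ lab x = i & D (iota x) q < theta.

(** Two nested McShane extensions: from the piece with label [i] to its
    [theta]-neighbourhood with the local constant [a i], then to the whole space
    with the constant [L + 1]. *)
Definition extension_values (z : X') : set R :=
  [set s | exists e q, [/\ K e, near_piece (lab e) q &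
    s = f e + a (lab e) * D (iota e) q + (L + 1) * D q z]].

Definition extension (z : X') : R := inf (extension_values z).

Lemma near_piece_self x : K x -> near_piece (lab x) (iota x).
Proof. by move=> Kx; exists x => //; rewrite semi_refl. Qed.

Lemma extension_values_neq0 z : extension_values z !=set0.
Proof.
have [x Kx] := K0; exists (f x + a (lab x) * D (iota x) (iota x) + (L + 1) * D
  (iota x) z).
by exists x, (iota x); split=> //; exact: near_piece_self.
Qed.

Lemma extension_values_lb z : has_lbound (extension_values z).
Proof.
exists (- M) => _ [e [q [Ke _ ->]]]; have /andP[a0 _] := aL Ke.
have : 0 <= a (lab e) * D (iota e) q by rewrite mulr_ge0// semi_ge0.
have L1 : 0 <= L + 1 by move: L0; lra.
have : 0 <= (L + 1) * D q z by rewrite mulr_ge0// semi_ge0.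
by have := fM e; rewrite ler_norml; lra.
Qed.

(** Go from [e] to a point [e'] of the same piece near [q] with the local
    estimate, then from [e'] to [x] with the global one; the slack between [L]
    and [L + 1] is worth [kappa] if the labels of [e] and [x] differ. *)
Lemma extension_value_ge e q z x : K e -> near_piece (lab e) q -> K x ->
  f x - 2 * eta - 2 * (L + 1) * theta + (if lab e == lab x then 0 else kappa)
    - (L + 1) * D (iota x) z <=
  f e + a (lab e) * D (iota e) q + (L + 1) * D q z.
Proof.
move=> Ke [e' [Ke' le'] e'q] Kx; have /andP[a0 aL1] := aL Ke.
have L1 : 0 <= L + 1 by move: L0; lra.
have De : D (iota e) (iota e') - theta <= D (iota e) q.
  have := semi_triangle sD (iota e) q (iota e').
  by rewrite (semi_sym sD q); move: e'q; lra.
have Dx : D (iota e') (iota x) - theta - D (iota x) z <= D q z.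
  have := semi_triangle sD (iota e') q (iota x).
  have := semi_triangle sD q z (iota x).
  by rewrite (semi_sym sD z); move: e'q; lra.
have ae : a (lab e) * (D (iota e) (iota e') - theta) <= a (lab e) * D (iota e)
  q.
  by rewrite ler_wpM2l.
have lx : (L + 1) * (D (iota e') (iota x) - theta - D (iota x) z) <= (L + 1) *
  D q z.
  by rewrite ler_wpM2l.
have at_ : a (lab e) * theta <= (L + 1) * theta by rewrite ler_wpM2r// ltW.
have := f_same Ke Ke' (esym le'); rewrite ler_norml => /andP[fee' _].
have := f_diff Ke' Kx; rewrite ler_norml => /andP[fe'x _].
have bonus : (if lab e == lab x then 0 else kappa) <= D (iota e') (iota x).
  case: eqP => [_|ne]; first exact: semi_ge0.
  by apply: separated => //; rewrite le'.
move: ae lx at_ fee' fe'x bonus.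
set s := (if _ then _ else _); set A := a (lab e);
  set E := D (iota e) (iota e').
set F := D (iota e') (iota x); lra.
Qed.

Lemma extension_lipschitz z w : `|extension z - extension w| <= (L + 1) * D z w.
Proof.
have L1 : 0 <= L + 1 by move: L0; lra.
have half u v : extension v <= extension u + (L + 1) * D u v.
  apply: le_inf_shift => [||_ [e [q [Ke qe ->]]]].
  - exact: extension_values_neq0.
  - exact: extension_values_lb.
  - exists (f e + a (lab e) * D (iota e) q + (L + 1) * D q v);
      first by exists e, q.
    have : (L + 1) * D q v <= (L + 1) * (D q u + D u v).
      by rewrite ler_wpM2l// semi_triangle.
    lra.
have := half z w; have := half w z; rewrite (semi_sym sD w) ler_norml; lra.
Qed.

Lemma extension_close x : K x ->
  `|extension (iota x) - f x| <= 2 * eta + 2 * (L + 1) * theta.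
Proof.
have L1 : 0 <= L + 1 by move: L0; lra.
have err0 : 0 <= (L + 1) * theta by rewrite mulr_ge0// ltW.
move=> Kx; rewrite ler_norml; apply/andP; split.
  rewrite lerBrDr; apply: lb_le_inf; first exact: extension_values_neq0.
  move=> _ [e [q [Ke qe ->]]]; apply: le_trans (extension_value_ge _ Ke qe Kx).
  rewrite (semi_refl sD) mulr0 subr0.
  have : 0 <= (if lab e == lab x then 0 else kappa).
    by case: ifP => // _; apply: le_trans small; move: err0 eta0; lra.
  lra.
have : extension (iota x) <= f x.
  apply: ge_inf; first exact: extension_values_lb.
  exists x, (iota x); split=> //; first exact: near_piece_self.
  by rewrite (semi_refl sD) !mulr0 !addr0.
by move: err0 eta0; lra.
Qed.

(** For a point near [x], values that come from another piece than that of [x]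
    are useless in the infimum: the bonus [kappa] of [extension_value_ge] makes
    them exceed the value that comes from [x] itself. *)
Lemma extension_local_lipschitz x z w : K x -> D (iota x) z < theta ->
  D (iota x) w < theta -> `|extension z - extension w| <= a (lab x) * D z w.
Proof.
move=> Kx xz xw; have /andP[a0 aL1] := aL Kx.
have L1 : 0 <= L + 1 by move: L0; lra.
have half u v : D (iota x) u < theta -> D (iota x) v < theta ->
    extension v <= extension u + a (lab x) * D u v.
  move=> xu xv; apply: le_inf_shift => [||_ [e [q [Ke qe ->]]]].
  - exact: extension_values_neq0.
  - exact: extension_values_lb.
  - have [lex|nlex] := eqVneq (lab e) (lab x).
      exists (f e + a (lab e) * D (iota e) v).
        exists e, v; split=> //; first by rewrite lex; exists x.
        by rewrite (semi_refl sD) mulr0 addr0.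
      rewrite lex -!addrA lerD2l.
      have := semi_triangle sD (iota e) q v; have := semi_triangle sD q u v.
      move=> quv eqv.
      have eqv' : D (iota e) v <= D (iota e) q + (D q u + D u v) by lra.
      apply: le_trans (ler_wpM2l a0 eqv') _;
        rewrite !mulrDr !addrA lerD2r lerD2l.
      by rewrite ler_wpM2r// semi_ge0.
    exists (f x + a (lab x) * D (iota x) v).
      exists x, v; split=> //; first by exists x.
      by rewrite (semi_refl sD) mulr0 addr0.
    have := extension_value_ge u Ke qe Kx; rewrite (negbTE nlex).
    have : a (lab x) * D (iota x) v <= a (lab x) * (D (iota x) u + D u v).
      by rewrite ler_wpM2l// semi_triangle.
    have : (L + 1) * D (iota x) u <= (L + 1) * theta by rewrite ler_wpM2l// ltW.
    have : a (lab x) * D (iota x) u <= (L + 1) * theta.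
      by rewrite ler_pM// ?semi_ge0// ltW.
    set E := f e + _ + _; move: small; lra.
have := half z w xz xw; have := half w z xw xz.
by rewrite (semi_sym sD w) ler_norml; lra.
Qed.

End extension.

(** * Exhaustion by compact sets with small Lipschitz constants *)

Section tame_sets.
Context {R : realType} (X : emtmSpace R).
Local Notation d := (@emdist R X).
Local Notation m := (@emeas R X).
Variables (f : X -> R) (eps : R).

(** Compact sets that split into finitely many disjoint compact pieces, encoded
    by a locally constant labelling, on which the Lipschitz constant of [f] is
    at most the asymptotic one plus [eps]. *)
Definition tame (K : set X) := compact K /\
  exists (lab : X -> nat) (a : nat -> R), [/\
    forall x, K x -> \forall y \near x, K y -> lab y = lab x,
    forall x, K x -> 0 <= a (lab x) <= slope f x + eps &
    forall x y, K x -> K y -> lab x = lab y ->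
      (`|f x - f y|%:E <= (a (lab x))%:E * d x y)%E].

Lemma tame_subset K C : tame K -> compact C -> C `<=` K -> tame C.
Proof.
move=> [_ [lab [a [labK aK fK]]]] cC CK; split=> //; exists lab, a; split.
- by move=> x Cx; apply: filterS (labK x (CK x Cx)) => y + Cy; apply; exact: CK.
- by move=> x Cx; apply: aK; exact: CK.
- by move=> x y Cx Cy; apply: fK; exact: CK.
Qed.

Lemma tame0 : tame set0.
Proof. by split; [exact: compact0|exists (fun=> 0%N), (fun=> 0); split]. Qed.

Lemma tame_setU K C : tame K -> tame C -> K `&` C = set0 -> tame (K `|` C).
Proof.
move=> [cK [lab [a [labK aK fK]]]] [cC [lab' [a' [labC aC fC]]]] KC.
split; first exact: compactU.
have disj x : K x -> C x -> False by move=> Kx Cx;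
  rewrite -[False]/(set0 x) -KC.
have near_notin (A B : set X) x : compact B -> (forall x, A x -> B x ->
  False) -> A x ->
    \forall y \near x, ~ B y.
  move=> cB AB Ax; have : open (~` B).
    by apply: closed_openC; apply: compact_closed cB;
      exact: emt_hausdorff (emtm_emt X).
  by move=> oB; apply: open_nbhs_nbhs; split=> // Bx; exact: AB Ax Bx.
(* Even labels for [K], odd labels for [C]. *)
pose l x := if `[< K x >] then (lab x).*2 else (lab' x).*2.+1.
pose b i := if odd i then a' i./2 else a i./2.
have lK x : K x -> l x = (lab x).*2 by rewrite /l => Kx; case: asboolP.
have lC x : C x -> l x = (lab' x).*2.+1.
  by rewrite /l => Cx; case: asboolP => // /disj /(_ Cx).
have bK i : b i.*2 = a i by rewrite /b odd_double doubleK.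
have bC i : b i.*2.+1 = a' i by rewrite /b /= odd_double uphalf_double.
exists l, b; split.
- move=> x [Kx|Cx].
    apply: filterS2 (labK x Kx) (near_notin _ _ x cC disj Kx) =>
      y lKy nCy [Ky|//].
    by rewrite !lK// lKy.
  have nK := near_notin _ _ x cK (fun x Cx Kx => disj x Kx Cx) Cx.
  apply: filterS2 (labC x Cx) nK => y lCy nKy [//|Cy].
  by rewrite !lC// lCy.
- by move=> x [Kx|Cx]; [rewrite lK// bK; exact: aK|rewrite lC// bC; exact: aC].
- move=> x y [Kx|Cx] [Ky|Cy].
  + by rewrite !lK// bK => /double_inj; exact: fK.
  + by rewrite lK// lC// => /(congr1 odd); rewrite /= !odd_double.
  + by rewrite lC// lK// => /(congr1 odd); rewrite /= !odd_double.
  + by rewrite !lC// bC => -[/double_inj]; exact: fC.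
Qed.

End tame_sets.

Section inner_regularity.
Context {R : realType} (X : emtmSpace R).
Local Notation m := (@emeas R X).
Implicit Types (A B K : set X).

Lemma measurable_compact K : compact K -> measurable (K : set (borel X)).
Proof.
move=> cK; rewrite -(setCK K); apply: measurableC; apply: measurable_open.
by apply: closed_openC; apply: compact_closed cK;
  exact: emt_hausdorff (emtm_emt X).
Qed.

Lemma emeas_fin (B : set (borel X)) : measurable B -> m B \is a fin_num.
Proof. by move=> mB; exact: fin_num_measure. Qed.

Lemma inner_compact (B : set (borel X)) (e : R) : measurable B -> 0 < e ->
  exists2 K : set X, compact K & K `<=` B /\ (m (B `\` K) < e%:E)%E.
Proof.
move=> mB e0; have mBfin := emeas_fin mB.
have [] := @ub_ereal_sup_adherent R [set m K | K in [set K : set X | compact K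
  /\ K `<=` B]] e e0.
  by rewrite -(@emtm_radon R X).
move=> _ [K [cK KB] <-]; rewrite -(@emtm_radon R X)// => lt_K.
exists K => //; split=> //; have mK := measurable_compact cK.
rewrite measureD//; last by rewrite ltey_eq mBfin.
rewrite (setIidr KB) lteBlDr ?emeas_fin//.
by move: lt_K; rewrite lteBlDr// addeC.
Qed.

End inner_regularity.

Section tame_exhaustion.
Context {R : realType} (X : emtmSpace R).
Local Notation d := (@emdist R X).
Local Notation m := (@emeas R X).
Variables (f : X -> R) (eps : R).
Hypotheses (bf : Lip_b d f) (eps0 : 0 < eps).
Local Notation tame := (tame f eps).
Implicit Types (A B E : set (borel X)).

Definition tame_exhausted (E : set (borel X)) := forall e : R, 0 < e ->
  exists2 K : set X, tame K & K `<=` E /\ (m (E `\` K) < e%:E)%E.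

Lemma measure_le_add A B E (e : R) : measurable A -> measurable B ->
  measurable E ->
  E `<=` A `|` B -> (m A < (e / 2)%:E)%E -> (m B < (e / 2)%:E)%E ->
    (m E < e%:E)%E.
Proof.
move=> mA mB mE EAB Ae Be.
apply: (@le_lt_trans _ _ (m A + m B)%E).
  apply: le_trans (measureU2 _ mA mB).
  by apply: le_measure => //; apply/mem_set => //; exact: measurableU.
by rewrite [e](splitr e) EFinD lteD.
Qed.

Lemma tame_measurable K : tame K -> measurable (K : set (borel X)).
Proof. by case=> cK _; exact: measurable_compact. Qed.

Lemma tame_exhausted_subset A E : measurable A -> measurable E -> A `<=` E ->
  tame_exhausted E -> tame_exhausted A.
Proof.
move=> mA mE AE tE e e0; have e20 : 0 < e / 2 by rewrite divr_gt0.
have [K tK [KE mK]] := tE _ e20; have mK' := tame_measurable tK.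
have [C cC [CAK mC]] := inner_compact (measurableI _ _ mA mK') e20.
have mC' := measurable_compact cC.
exists C; first by apply: tame_subset tK cC _ => x /CAK [].
split; first by move=> x /CAK [].
apply: (@measure_le_add (E `\` K) (A `&` K `\` C)) => //.
- exact: measurableD.
- by apply: measurableD => //; exact: measurableI.
- exact: measurableD.
- move=> x [Ax nCx]; have [Kx|nKx] := pselect (K x); first by right.
  by left; split=> //; exact: AE.
Qed.

Lemma tame_exhaustedU A E : measurable A -> measurable E ->
  tame_exhausted A -> tame_exhausted E -> tame_exhausted (A `|` E).
Proof.
move=> mA mE tA tE e e0; have e20 : 0 < e / 2 by rewrite divr_gt0.
have [K tK [KA mK]] := tA _ e20; have mK' := tame_measurable tK.
have mEK : measurable (E `\` K) by exact: measurableD.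
have [C tC [CEK mC]] := tame_exhausted_subset mEK mE (@subDsetl _ _ _) tE e20.
have mC' := tame_measurable tC.
exists (K `|` C).
  apply: tame_setU => //; rewrite -subset0 => x [Kx /CEK[_]]; exact.
split; first by move=> x [/KA Ax|/CEK[Ex _]]; [left|right].
apply: (@measure_le_add (A `\` K) (E `\` K `\` C)) => //.
- exact: measurableD.
- exact: measurableD.
- by apply: measurableD; exact: measurableU.
- move=> x [AEx nKC]; have nKx : ~ K x by move=> Kx; apply: nKC; left.
  have nCx : ~ C x by move=> Cx; apply: nKC; right.
  by case: AEx => [Ax|Ex]; [left|right].
Qed.

(** Inner regularity reduces the claim to a compact set, which is covered by
    finitely many of the given neighbourhoods. *)
Lemma tame_exhausted_local A : measurable A ->
  (forall x, A x -> exists2 U : set X, open_nbhs x U & tame_exhausted (A `&`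
    U)) ->
  tame_exhausted A.
Proof.
move=> mA locA e e0; have e20 : 0 < e / 2 by rewrite divr_gt0.
have [C cC [CA mC]] := inner_compact mA e20; have mC' := measurable_compact cC.
pose I := {U : set X | open U /\ tame_exhausted (A `&` U)}.
have t0 : tame_exhausted (A `&` set0).
  rewrite setI0 => r r0; exists set0; first exact: tame0.
  by split=> //; rewrite set0D measure0 lte_fin.
pose i0 : I := exist _ set0 (conj open0 t0).
have [| |[U [oU tU]] /= CU] := @directed_compact X I i0 C (fun i => sval i) cC.
- move=> [U [oU tU]] [V [oV tV]].
  have oUV : open (U `|` V) by exact: openU.
  have tUV : tame_exhausted (A `&` (U `|` V)).
    by rewrite setIUr; apply: tame_exhaustedU => //; apply: measurableI => //;
      exact: measurable_open.
  by exists (exist _ (U `|` V) (conj oUV tUV)).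
- move=> x Cx; have [U [oU Ux] tU] := locA x (CA x Cx).
  exists (exist _ U (conj oU tU)) => /=.
  by apply: filterS (open_nbhs_nbhs (conj oU Ux)).
have mAU : measurable (A `&` U : set (borel X)).
  by apply: measurableI => //; exact: measurable_open.
have CAU : C `<=` A `&` U by move=> x Cx; split; [exact: CA|exact: CU].
have [K tK [KC mK]] := tame_exhausted_subset mC' mAU CAU tU e20.
have mK' := tame_measurable tK.
exists K => //; split; first exact: subset_trans KC CA.
apply: (@measure_le_add (A `\` C) (C `\` K)) => //; try exact: measurableD.
by move=> x [Ax nKx]; have [Cx|nCx] := pselect (C x); [right|left].
Qed.

Lemma tame_exhausted_good A (a : R) : measurable A -> 0 <= a ->
  lipschitz_on d a f A -> (forall x, A x -> a <= slope f x + eps) ->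
    tame_exhausted A.
Proof.
move=> mA a0 fA aA e e0; have [C cC [CA mC]] := inner_compact mA e0.
exists C => //; split=> //; exists (fun=> 0%N), (fun=> a); split.
- by move=> x Cx; apply: nearW.
- by move=> x Cx; rewrite a0 aA//; exact: CA.
- by move=> x y Cx Cy _; apply: fA; exact: CA.
Qed.

Lemma measurable_slope_lt (r : R) :
  measurable ([set x | slope f x < r] : set (borel X)).
Proof.
rewrite (_ : mkset _ = [set x | (lip f x < r%:E)%E]).
  by apply: measurable_open; exact: open_lip_lt.
by apply/seteqP; split=> x /=; rewrite -slopeE// lte_fin.
Qed.

(** Cutting [X] along the levels of the slope in steps of [eps] is what bounds
    the Lipschitz constant from above by the slope: near a point of the level [n
    * eps <= slope f < (n + 1) * eps] the constant [(n + 1) * eps] is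
    admissible, and it exceeds the slope on the whole level by at most [eps]. *)
Lemma tame_exhausted_slope_lt n : tame_exhausted [set x | slope f x < n%:R *
  eps].
Proof.
elim: n => [|n IHn].
  rewrite mul0r (_ : mkset _ = set0).
    apply: (@tame_exhausted_good _ 0) => //.
  by apply/seteqP; split=> // x /=; rewrite ltNge slope_ge0.
pose A := [set x | slope f x < n.+1%:R * eps] `\` [set x | slope f x < n%:R *
  eps].
have mA : measurable (A : set (borel X)).
  by apply: measurableD; exact: measurable_slope_lt.
have -> : [set x | slope f x < n.+1%:R * eps] = [set x | slope f x < n%:R *
  eps] `|` A.
  rewrite /A setDE setUIr setUCr setIT; apply/seteqP; split=> x; [by right|].
  case=> //= /lt_le_trans; apply; rewrite ler_pM2r// ler_nat; exact: leqnSn.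
apply: tame_exhaustedU => //; first exact: measurable_slope_lt.
apply: tame_exhausted_local => // x [/= xn1 xn].
have a0 : 0 <= n.+1%:R * eps by rewrite mulr_ge0// ltW.
have [|U oU fU] := @lip_lt _ _ f x (n.+1%:R * eps);
  first by rewrite -slopeE// lte_fin.
exists U => //; apply: (@tame_exhausted_good _ (n.+1%:R * eps)) => //.
- by apply: measurableI => //; apply: measurable_open; case: oU.
- move=> y z [_ Uy] [_ Uz]; apply: (Lip_lt _ fU) => //; exact: emdist_ge0.
- move=> y [[_ /negP]]; rewrite -leNgt => ny _.
  by rewrite -natr1 mulrDl mul1r lerD2r.
Qed.

Lemma tame_exhaustion (e : R) : 0 < e ->
  exists2 K : set X, tame K & (m (~` K) < e%:E)%E.
Proof.
move=> e0; have [L L0 fL] := Lip_b_lipschitz bf.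
have [K tK [_ mK]] := tame_exhausted_slope_lt (Num.bound (L / eps)) e0.
exists K => //; rewrite -setTD.
rewrite (_ : setT = [set x | slope f x < (Num.bound (L / eps))%:R * eps])//.
apply/seteqP; split=> // x _ /=.
apply: (@le_lt_trans _ _ L); first by apply: slope_le_lipschitz fL x => //;
  exact: ltW.
by rewrite -ltr_pdivrMr//; apply: archi_boundP; rewrite divr_ge0// ltW.
Qed.

End tame_exhaustion.

(** * Extension of Lipschitz functions along the embedding *)

Section Lip_b_extension.
Context {R : realType} (X X' : emtmSpace R) (iota : X -> X').
Hypothesis emb : measure_preserving_embedding iota.
Local Notation d := (@emdist R X).
Local Notation d' := (@emdist R X').

Lemma tame_extension (f : X -> R) (K : set X) (eps M L : R) : Lip_b d f ->
  0 < eps <= 1 -> 0 <= M -> (forall x, `|f x| <= M) ->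
  0 <= L -> lipschitz_on d L f setT -> tame f eps K ->
  exists v : X' -> R, [/\ Lip_b d' v, forall z, `|v z| <= M,
    lipschitz_on d' (L + 1) v setT,
    forall x, K x -> `|v (iota x) - f x| <= eps &
    forall x, K x -> slope v (iota x) <= slope f x + eps].
Proof.
move=> bf /andP[eps0 eps1] M0 fM L0 fL [cK [lab [a [labK aK fK]]]].
have L1 : 0 < L + 1 by lra.
have [K0|K0] := pselect (K !=set0); last first.
  have nK x : K x -> False by move=> Kx; apply: K0; exists x.
  have lip0 : lipschitz_on d' (L + 1) (fun _ => 0) setT.
    by move=> z w _ _; rewrite subrr normr0 mule_ge0 ?lee_fin ?(ltW L1)//
      emdist_ge0.
  exists (fun _ => 0); split=> //; last 3 first.
  - by move=> z; rewrite normr0.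
  - by move=> x /nK.
  - by move=> x /nK.
  split; first exact: cst_continuous.
    by apply: (@bounded_funI _ _ 0) => x; rewrite normr0.
  by apply: le_lt_trans (Lip_le _ lip0) (ltry _); exact: ltW.
have aL x : K x -> 0 <= a (lab x) <= L + 1.
  move=> Kx; have /andP[-> /le_trans] := aK x Kx; apply.
  by rewrite lerD// slope_le_lipschitz.
(* [kappa] comes first: the errors [eta] and [theta] must be small compared with
   the gain [kappa] that the slack between [L] and [L + 1] yields when the label
   changes. The index [n.+1] keeps [kappa] positive. *)
have [D0 [n [sD0 sepD0]]] := compact_label_separation emb cK labK.
pose kappa : R := n.+1%:R^-1.
have kappa0 : 0 < kappa by rewrite invr_gt0.
pose eta := Num.min (kappa / 4) (eps / 4).
pose theta := Num.min (kappa / (8 * (L + 1))) (eps / (4 * (L + 1))).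
have eta0 : 0 < eta by rewrite lt_min !divr_gt0.
have theta0 : 0 < theta by rewrite lt_min !divr_gt0// mulr_gt0.
have [etak etae] : eta <= kappa / 4 /\ eta <= eps / 4.
  by rewrite !ge_min !lexx orbT.
have [thetak thetae] : (L + 1) * theta <= kappa / 8 /\ (L + 1) * theta <= eps /
  4.
  have E (x k : R) : 0 < k -> x / (k * (L + 1)) = x / k / (L + 1).
    by move=> k0; rewrite invfM mulrA.
  split; rewrite mulrC -ler_pdivlMr// /theta -E// ge_min lexx ?orbT//.
pose c i j : R := if i == j then a i else L.
have [D1 sD1 fD1] : exists2 D, semidistance D & forall x y, K x -> K y ->
    `|f x - f y| <= c (lab x) (lab y) * D (iota x) (iota y) + eta.
  apply: compact_label_lipschitz => //; first by case: bf.
  - by move=> x y Kx Ky; rewrite /c; case: ifP => // _; have /andP[] := aL x Kx.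
  - move=> x y Kx Ky; rewrite /c; case: eqP => [lxy|_]; first exact: fK.
    exact: fL.
have [D2 sD2 fD2] : exists2 D, semidistance D & forall x y, K x -> K y ->
    `|f x - f y| <= L * D (iota x) (iota y) + eta.
  apply: (@compact_label_lipschitz _ _ _ _ emb K (fun=> 0%N) (fun _ _ => L)) =>
    //.
  - by case: bf.
  - by move=> x Kx; apply: nearW.
  - by move=> x y _ _; exact: fL.
pose D x y := Num.max (D0 x y) (Num.max (D1 x y) (D2 x y)).
have sD : semidistance D by apply: semidistance_max => //;
  exact: semidistance_max.
have D0D x y : D0 x y <= D x y by rewrite le_max lexx.
have D1D x y : D1 x y <= D x y by rewrite !le_max lexx !orbT.
have D2D x y : D2 x y <= D x y by rewrite !le_max lexx !orbT.
have f_same x y : K x -> K y -> lab x = lab y ->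
    `|f x - f y| <= a (lab x) * D (iota x) (iota y) + eta.
  move=> Kx Ky lxy; apply: le_trans (fD1 x y Kx Ky) _.
  rewrite /c lxy eqxx lerD2r ler_wpM2l//.
  by rewrite -lxy; have /andP[] := aL x Kx.
have f_diff x y : K x -> K y -> `|f x - f y| <= L * D (iota x) (iota y) + eta.
  by move=> Kx Ky; apply: le_trans (fD2 x y Kx Ky) _; rewrite lerD2r ler_wpM2l.
have sep x y : K x -> K y -> lab x <> lab y -> kappa <= D (iota x) (iota y).
  move=> Kx Ky /eqP lxy; apply: le_trans (D0D _ _).
  rewrite /kappa -[leLHS]mul1r ler_pdivrMr//.
  apply: le_trans (sepD0 x y Kx Ky lxy) _;
    rewrite mulrC ler_wpM2l ?semi_ge0// ler_nat; exact: leqnSn.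
have small : 2 * eta + 4 * (L + 1) * theta <= kappa.
  by move: etak thetak; rewrite -[4 * _ * _]mulrA; set t := (L + 1) * theta;
    lra.
pose w := extension iota K lab a f L D theta.
have wL z z' : `|w z - w z'| <= (L + 1) * D z z'.
  exact: (@extension_lipschitz _ _ _ iota K lab a f M L D theta).
have wK x : K x -> `|w (iota x) - f x| <= eps.
  move=> Kx; apply: le_trans (@extension_close _ _ _ iota K lab a f M L D eta
    theta kappa
    sD K0 L0 (ltW eta0) theta0 fM aL f_same f_diff sep small x Kx) _.
  by move: etae thetae; rewrite -[2 * _ * _]mulrA; set t := (L + 1) * theta;
    lra.
pose v z := clamp M (w z).
have vL z z' : `|v z - v z'| <= (L + 1) * D z z'.
  by apply: le_trans (wL z z'); exact: clamp_lipschitz.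
have vM z : `|v z| <= M by exact: clamp_le.
have lipv : lipschitz_on d' (L + 1) v setT.
  by apply: (semi_lipschitz_on sD) => [|z z' _ _]; [exact: ltW|exact: vL].
have bv : Lip_b d' v.
  split.
  - exact: (semi_lipschitz_continuous sD (ltW L1) vL).
  - exact: bounded_funI vM.
  - by apply: le_lt_trans (Lip_le _ lipv) (ltry _); exact: ltW.
exists v; split=> // x Kx.
  by rewrite -[f x](clamp_id (fM x)); apply: le_trans (wK x Kx);
    exact: clamp_lipschitz.
have /andP[a0 aS] := aK x Kx; apply: le_trans aS.
rewrite -lee_fin slopeE//; apply: le_trans (lip_le v (semi_near _ sD theta0)) _.
apply: Lip_le => //; apply: (semi_lipschitz_on sD) => // z z' xz xz'.
apply: le_trans; first exact: clamp_lipschitz.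
exact: (@extension_local_lipschitz _ _ _ iota K lab a f M L D eta theta kappa).
Qed.

End Lip_b_extension.

(** * Change of variables along the embedding *)

Section pullback.
Context {R : realType} (X X' : emtmSpace R) (iota : X -> X').
Hypothesis emb : measure_preserving_embedding iota.
Local Notation d := (@emdist R X).
Local Notation d' := (@emdist R X').
Local Notation m := (@emeas R X).
Local Notation m' := (@emeas R X').
Variables (p : R) (p1 : 1 < p).
Local Notation L := (Lfun m p%:E).
Local Notation L' := (Lfun m' p%:E).

Lemma measurable_embedding :
  measurable_fun setT (iota : borel X -> borel X').
Proof.
apply: (@measurability _ _ (borel X) (borel X') setT iota (@open X') erefl).
move=> _ [U oU <-]; rewrite setTI.
apply: measurable_open.
have /continuousP ciota : continuous iota by move=> x;
  exact: (mpe_continuous emb).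
exact: ciota.
Qed.

Lemma measurable_pullback (h : X' -> R) :
  measurable_fun setT (h : borel X' -> R) ->
  measurable_fun setT (h \o iota : borel X -> R).
Proof. by move=> mh; exact: (measurableT_comp mh measurable_embedding). Qed.

Lemma Lnorm_pullback (h : X' -> R) : measurable_fun setT (h : borel X' -> R) ->
  'N[m]_(p%:E)[EFin \o (h \o iota)]%E = 'N[m']_(p%:E)[EFin \o h]%E.
Proof.
move=> mh; rewrite unlock /=; congr (_ `^ _)%E.
pose F (y : borel X') : \bar R := (`|h y| `^ p)%R%:E.
have mF : measurable_fun setT F by exact: measurable_normr_powR.
have F0 : {in setT, forall y, (0 <= F y)%E} by move=> y _;
  rewrite lee_fin powR_ge0.
have := ge0_integral_pushforward measurable_embedding m measurableT mF F0.
rewrite preimage_setT => <-; apply: eq_measure_integral => [|mi B mB _].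
  exact: measurable_embedding.
exact: (mpe_pushforward emb mB).
Qed.

Lemma Lfun_pullback (h : X' -> R) : h \in L' -> h \o iota \in L.
Proof.
move=> hL; have mh := Lfun_measurable hL; apply: LfunE;
  first exact: measurable_pullback.
by rewrite Lnorm_pullback// nrmE// ltry.
Qed.

Lemma nrm_pullback (h : X' -> R) : h \in L' -> nrm m p (h \o iota) = nrm m' p h.
Proof. by move=> hL; rewrite /nrm Lnorm_pullback//;
  exact: Lfun_measurable hL. Qed.

Lemma ae_pullback (P : X' -> Prop) :
  {ae m', forall y, P y} -> {ae m, forall x, P (iota x)}.
Proof.
move=> [N [mN N0 PN]]; exists (iota @^-1` N); split.
- by rewrite -[X in measurable X]setTI; exact: measurable_embedding.
- by rewrite -N0 -(mpe_pushforward emb mN).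
- by move=> x nPx; exact: PN.
Qed.

Lemma Lip_b_pullback (v : X' -> R) : Lip_b d' v -> Lip_b d (v \o iota).
Proof.
move=> bv; have [cv _ _] := bv; have [M _ vM] := Lip_b_bounded bv.
have [K K0 vK] := Lip_b_lipschitz bv; split.
- by move=> x; apply: continuous_comp; [exact: mpe_continuous emb x|exact: cv].
- by apply: (@bounded_funI _ _ M) => x; exact: vM.
- apply: le_lt_trans (ltry K); apply: Lip_le; first exact: ltW.
  by move=> x y _ _; rewrite -(mpe_isometry emb); exact: vK.
Qed.

(** Neighbourhoods of [iota x] pull back to neighbourhoods of [x], on which the
    Lipschitz constant can only be smaller. *)
Lemma slope_pullback (v : X' -> R) x : Lip_b d' v ->
  slope (v \o iota) x <= slope v (iota x).
Proof.
move=> bv; rewrite -lee_fin !slopeE//; last exact: Lip_b_pullback.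
apply: le_ereal_inf_tmp => _ [U xU <-].
apply: le_trans (lip_le (U := iota @^-1` U) _ _) _.
  exact: (mpe_continuous emb).
apply: ereal_inf_le_tmp => l [l0 vl]; split=> // y z Uy Uz.
by rewrite -(mpe_isometry emb); exact: vl.
Qed.

End pullback.

(** * Invariance of the Cheeger energy and of the minimal relaxed gradient *)

Section invariance.
Context {R : realType} (X X' : emtmSpace R) (iota : X -> X').
Hypothesis emb : measure_preserving_embedding iota.
Local Notation d := (@emdist R X).
Local Notation d' := (@emdist R X').
Local Notation m := (@emeas R X).
Local Notation m' := (@emeas R X').
Variables (p : R) (p1 : 1 < p).
Local Notation L := (Lfun m p%:E).
Local Notation L' := (Lfun m' p%:E).
Let p0 : 0 < p. Proof. exact: lt_trans p1. Qed.

Lemma nrm_indic_le (B : set (borel X)) (r : R) : measurable B -> 0 <= r ->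
  (m B <= (r `^ p)%:E)%E ->
  (\1_B : borel X -> R) \in L /\ nrm m p \1_B <= r.
Proof.
move=> mB r0 Br.
have BL : (\1_B : borel X -> R) \in L.
  apply: (@bounded_Lfun _ _ _ p1 _ 1); first exact: measurable_indic.
  by move=> x; rewrite indicE; case: (x \in B); rewrite ?normr0 ?normr1.
split=> //; rewrite leNgt; apply/negP => lt_r.
have : r `^ p < nrm m p \1_B `^ p by rewrite gt0_ltr_powR// ?nnegrE ?nrm_ge0.
rewrite ltNge -lee_fin -powR_nrm//.
rewrite (_ : (\int[m]_x _)%E = m B) ?Br//.
have := integral_indic m measurableT mB; rewrite setIT => <-;
  apply: eq_integral => x _.
rewrite indicE; case: (x \in B); first by rewrite normr1 powR1.
by rewrite normr0 powR0// gt_eqF.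
Qed.

(** Off a set of small measure, bounds on values and slopes cost little in
    [L^p]; on that exceptional set only the uniform bounds are available. *)
Lemma Lip_b_energy_extension (f : X -> R) (e : R) : Lip_b d f -> 0 < e ->
  exists v : X' -> R, [/\ Lip_b d' v, nrm m p (v \o iota \- f) <= e &
    nrm m' p (slope v) <= nrm m p (slope f) + e].
Proof.
move=> bf e0; have [M M0 fM] := Lip_b_bounded bf.
have [K K0 fK] := Lip_b_lipschitz bf.
have oneL : (cst 1 : borel X -> R) \in L by exact: Lfun_cst.
pose I := nrm m p (cst 1).
have I0 : 0 <= I by exact: nrm_ge0.
pose C := 2 * M + (K + 1).
have C0 : 0 < C by rewrite /C; lra.
pose eps := Num.min 1 (e / 2 / (I + 1)).
have eps0 : 0 < eps by rewrite lt_min ltr01 !divr_gt0//; lra.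
have epsI : eps * I <= e / 2.
  apply: (@le_trans _ _ (e / 2 / (I + 1) * I)).
    by rewrite ler_wpM2r// ge_min lexx orbT.
  by rewrite mulrAC ler_pdivrMr ?ler_wpM2l ?divr_ge0 ?(ltW e0)//; lra.
pose r := e / 2 / C.
have r0 : 0 < r by rewrite !divr_gt0.
have rC : r * C = e / 2 by rewrite /r divfK// gt_eqF.
have [A tA mA] := tame_exhaustion bf eps0 (powR_gt0 p r0).
have eps01 : 0 < eps <= 1 by rewrite eps0 ge_min lexx.
have [v [bv vM vK vf vs]] := tame_extension emb bf eps01 (ltW M0) fM (ltW K0)
  fK tA.
have mAC : measurable (~` A : set (borel X)).
  by apply: measurableC; exact: tame_measurable tA.
have [AL Ar] := nrm_indic_le mAC (ltW r0) (ltW mA).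
set J : borel X -> R := \1_(~` A) in AL Ar.
have JA x : A x -> J x = 0 by move=> Ax; rewrite /J indicE memNset//; exact.
have JnA x : ~ A x -> J x = 1 by move=> nAx; rewrite /J indicE mem_set.
have vfL : v \o iota \- f \in L.
  have viL := Lfun_pullback emb (Lip_b_Lfun p1 bv).
  exact: (LfunB p1 viL (Lip_b_Lfun p1 bf)).
have errL c c' : (fun x => c * cst 1 x + c' * J x) \in L.
  by apply: (LfunD p1); exact: LfunZ.
have nrm_err c c' : 0 <= c -> 0 <= c' ->
    nrm m p (fun x => c * cst 1 x + c' * J x) <= c * I + c' * r.
  move=> c0 c0'; apply: le_trans (nrmD p1 (LfunZ p1 c oneL) (LfunZ p1 c' AL)) _.
  by rewrite !nrmZ// (ger0_norm c0) (ger0_norm c0') lerD2l ler_wpM2l.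
have J0 x : 0 <= J x by have [/JA->|/JnA->] := pselect (A x).
exists v; split=> //.
  apply: (@le_trans _ _ (nrm m p (fun x => eps * cst 1 x + 2 * M * J x))).
    apply: ae_le_nrm => //; apply: aeW => x.
    rewrite [leRHS]ger0_norm; last
      by rewrite addr_ge0// mulr_ge0 ?(ltW eps0)//; lra.
    rewrite /= mulr1; have [Ax|nAx] := pselect (A x).
      by rewrite JA// mulr0 addr0 vf.
    rewrite JnA// mulr1; apply: le_trans (ler_normB _ _) _.
    by have := vM (iota x); have := fM x; lra.
  apply: le_trans (nrm_err _ _ (ltW eps0) _) _; first by lra.
  have : 2 * M * r <= r * C by rewrite mulrC ler_wpM2l ?(ltW r0)// /C; lra.
  by rewrite rC; lra.
have svL := slope_Lfun p1 bv; have sfL := slope_Lfun p1 bf.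
rewrite -(nrm_pullback emb svL).
apply: (@le_trans _ _ (nrm m p (slope f \+ (fun x =>
  eps * cst 1 x + (K + 1) * J x)))).
  apply: ae_le_nrm => //; [exact: (Lfun_pullback emb svL)|exact: LfunD|].
  apply: aeW => x; have e0' : 0 <= eps * cst 1 x + (K + 1) * J x.
    by rewrite addr_ge0// mulr_ge0 ?(ltW eps0)//; lra.
  have rhs0 : 0 <= slope f x + (eps * cst 1 x + (K + 1) * J x).
    by rewrite addr_ge0// slope_ge0.
  rewrite /= (ger0_norm (slope_ge0 _ _)) (ger0_norm rhs0) /= mulr1.
  have [Ax|nAx] := pselect (A x); first by rewrite JA// mulr0 addr0 vs.
  rewrite JnA// mulr1; apply: (@le_trans _ _ (K + 1)).
    by apply: slope_le_lipschitz => //; lra.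
  by have := slope_ge0 f x; lra.
apply: le_trans (nrmD p1 sfL (errL _ _)) _; rewrite lerD2l.
have K1 : 0 <= K + 1 by lra.
apply: le_trans (nrm_err _ _ (ltW eps0) K1) _.
have : (K + 1) * r <= r * C by rewrite mulrC ler_wpM2l ?(ltW r0)// /C; lra.
by rewrite rC; lra.
Qed.

(** One inequality is [slope_pullback], the other [Lip_b_energy_extension]. *)
Lemma CE_pullback (f' : X' -> R) : f' \in L' -> CE p (f' \o iota) = CE p f'.
Proof.
move=> fL'; have fL := Lfun_pullback emb fL'.
have le_of_lt (a b : \bar R) : (0 <= b)%E -> (forall r : R, (b < r%:E)%E ->
  (a <= r%:E)%E) ->
    (a <= b)%E.
  case: b => [b| |] // _ ab; last by rewrite leey.
  by apply/lee_addgt0Pr => e e0; rewrite -EFinD; apply: ab;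
    rewrite lte_fin ltrDl.
apply/eqP; rewrite eq_le; apply/andP; split.
  apply: le_of_lt => [|r fr]; first exact: CE_ge0.
  apply: CE_le => // e e0; have [v [bv vf vr]] := CE_lt p1 fL' fr e0.
  exists (v \o iota); split; first exact: Lip_b_pullback.
    rewrite (_ : (v \o iota) \- (f' \o iota) = (v \- f') \o iota)//.
    by rewrite (nrm_pullback emb (LfunB p1 (Lip_b_Lfun p1 bv) fL')) ltW.
  apply: le_trans (ltW vr); rewrite lee_fin ge0_ler_powR ?(ltW p0)// ?nnegrE
    ?nrm_ge0//.
  have svL := slope_Lfun p1 bv; rewrite -(nrm_pullback emb svL).
  apply: ae_le_nrm => //; [exact/slope_Lfun/Lip_b_pullback|exact:
    Lfun_pullback|].
  apply: aeW => x; rewrite !ger0_norm ?slope_ge0//; exact: slope_pullback.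
apply: le_of_lt => [|r fr]; first exact: CE_ge0.
apply: CE_le => // e e0; have e20 : 0 < e / 2 by rewrite divr_gt0.
have [u [bu uf ur]] := CE_lt p1 fL fr e20.
rewrite lte_fin in ur.
have rE : (r `^ p^-1) `^ p = r.
  have r0 : 0 <= r by rewrite -lee_fin (le_trans _ (ltW fr))// CE_ge0.
  by rewrite -powRrM mulVf ?gt_eqF// powRr1.
have ur' : nrm m p (slope u) < r `^ p^-1.
  rewrite ltNge; apply/negP => le_u; move: ur; rewrite ltNge => /negP; apply.
  by rewrite -[leLHS]rE ge0_ler_powR ?(ltW p0)// ?nnegrE ?nrm_ge0 ?powR_ge0.
pose h := Num.min (e / 2) (r `^ p^-1 - nrm m p (slope u)).
have h0 : 0 < h by rewrite lt_min e20 subr_gt0.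
have [v [bv vu vr]] := Lip_b_energy_extension bu h0.
have he : h <= e / 2 by rewrite ge_min lexx.
have hr : h <= r `^ p^-1 - nrm m p (slope u) by rewrite ge_min lexx orbT.
have viL := Lfun_pullback emb (Lip_b_Lfun p1 bv).
exists v; split=> //.
  rewrite -(nrm_pullback emb (LfunB p1 (Lip_b_Lfun p1 bv) fL')).
  rewrite (_ : (v \- f') \o iota = (v \o iota) \- (f' \o iota))//.
  apply: le_trans (nrm_triangle p1 viL (Lip_b_Lfun p1 bu) fL) _.
  by rewrite [leRHS](splitr e) lerD ?(ltW uf)// (le_trans vu).
rewrite lee_fin -[leRHS]rE ge0_ler_powR ?(ltW p0)// ?nnegrE ?nrm_ge0
  ?powR_ge0//.
by apply: le_trans vr _; rewrite -lerBrDl.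
Qed.

Lemma strong_gradient_pullback (f' G' : X' -> R) : f' \in L' ->
  strong_gradient p f' G' -> strong_gradient p (f' \o iota) (G' \o iota).
Proof.
move=> fL' [GL' fG]; split; first exact: Lfun_pullback.
move=> e e0; have [v [g [bv gL' vg vf gG]]] := fG e e0.
exists (v \o iota), (g \o iota); split.
- exact: Lip_b_pullback.
- exact: Lfun_pullback.
- by move=> x; apply: le_trans (slope_pullback emb x bv) (vg _).
- rewrite (_ : (v \o iota) \- (f' \o iota) = (v \- f') \o iota)//.
  by rewrite (nrm_pullback emb (LfunB p1 (Lip_b_Lfun p1 bv) fL')).
- rewrite (_ : (g \o iota) \- (G' \o iota) = (g \- G') \o iota)//.
  by rewrite (nrm_pullback emb (LfunB p1 gL' GL')).
Qed.

(** On a compact set the embedding is a homeomorphism onto its image, hence maps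
    Borel sets to Borel sets. *)
Lemma measurable_image_compact (K : set X) (A : set (borel X)) : compact K ->
  measurable A -> measurable (iota @` (K `&` A) : set (borel X')).
Proof.
move=> cK mA.
have closed_image (C : set X) : closed C ->
    measurable (iota @` (K `&` C) : set (borel X')).
  move=> clC; apply: measurable_compact; apply: continuous_compact.
    by apply: continuous_subspaceT => x; exact: (mpe_continuous emb).
  by apply: (subclosed_compact _ cK) => //;
    apply: closedI => //; apply: compact_closed cK;
      exact: emt_hausdorff (emtm_emt X).
have compl (B : set X) : measurable (iota @` (K `&` B) : set (borel X')) ->
    measurable (iota @` (K `&` ~` B) : set (borel X')).
  move=> mB; rewrite (_ : _ @` _ = iota @` (K `&` setT) `\` iota @` (K `&` B)).
    by apply: measurableD => //; exact: closed_image closedT.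
  apply/seteqP; split=> [_ [x [Kx nBx] <-]|_ [[x [Kx _] <-] nBx]].
    split; first by exists x.
    by move=> [y [Ky By] /(mpe_injective emb) yx]; apply: nBx; rewrite -yx.
  by exists x => //; split=> // Bx; apply: nBx; exists x.
pose S := [set B : set X | measurable (iota @` (K `&` B) : set (borel X'))].
have SP : sigma_algebra setT S.
  split.
  - by rewrite /S /= setI0 image_set0.
  - by move=> B SB; rewrite setTD; exact: compl.
  - move=> F SF; rewrite /S /= setI_bigcupr image_bigcup.
    exact: bigcupT_measurable.
have : <<s @open X >> `<=` S.
  apply: smallest_sub SP _ => U oU.
  by rewrite /S /= -[U]setCK; apply: compl; apply: closed_image;
    exact: open_closedC.
exact.
Qed.

(** The measure lives on countably many compact sets, on each of which the
    embedding has a Borel inverse. *)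
Lemma Lfun_pullback_surjective (f : X -> R) : f \in L ->
  exists2 f' : X' -> R, f' \in L' & f' \o iota = f %[ae m].
Proof.
move=> fL; have mf := Lfun_measurable fL.
have /choice[K KP] (n : nat) : exists K : set X, compact K /\
    (m (~` K) < n.+1%:R^-1%:E)%E.
  have [|K cK [_ mK]] := @inner_compact _ X setT n.+1%:R^-1 measurableT;
    first by [].
  by exists K; rewrite -setTD.
have cK n : compact (K n) by case: (KP n).
pose S := \bigcup_n K n.
have mS : measurable (S : set (borel X)).
  by apply: bigcupT_measurable => n; exact: measurable_compact.
have S0 : m (~` S) = 0%E.
  apply/eqP; rewrite eq_le measure_ge0 andbT; apply/lee_addgt0Pr => e e0;
    rewrite add0e.
  have : n.+1%:R^-1 @[n --> \oo] --> (0 : R) by exact: cvg_harmonic.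
  move=> /cvgrPdist_lt/(_ e e0)[n _ /(_ n (leqnn n))].
  rewrite /= sub0r normrN ger0_norm// => ne.
  have [_ /ltW mK] := KP n; apply: le_trans (le_trans mK _);
    last by rewrite lee_fin ltW.
  apply: le_measure.
  - by apply/mem_set; exact: measurableC.
  - by apply/mem_set; apply: measurableC; exact: measurable_compact (cK n).
  - by apply: subsetC => x Kx; exists n.
pose f' (y : X') : R := if pselect (exists2 x, S x & iota x = y) is left ex
  then f (projT1 (cid2 ex)) else 0.
have f'S x : S x -> f' (iota x) = f x.
  move=> Sx; rewrite /f'; case: pselect => [ex|[]]; last by exists x.
  by case: (cid2 ex) => y Sy /(mpe_injective emb) /= ->.
have f'0 y : ~ (exists2 x, S x & iota x = y) -> f' y = 0.
  by rewrite /f'; case: pselect.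
have mf' : measurable_fun setT (f' : borel X' -> R).
  move=> _ B mB; rewrite setTI.
  have mKB n : measurable (iota @` (K n `&` (f @^-1` B)) : set (borel X')).
    apply: measurable_image_compact => //.
    by rewrite -[_ @^-1` _]setTI; exact: mf.
  have mKT n : measurable (iota @` (K n `&` setT) : set (borel X')).
    by apply: measurable_image_compact => //; exact: measurableT.
  have mon : measurable (\bigcup_n iota @` (K n `&` (f @^-1` B)) : set (borel
    X')).
    exact: bigcupT_measurable.
  have moff : measurable (~` \bigcup_n iota @` (K n `&` setT) : set (borel X')).
    by apply: measurableC; exact: bigcupT_measurable.
  have [B0|nB0] := pselect (B 0).
    rewrite (_ : _ @^-1` _ = \bigcup_n iota @` (K n `&` (f @^-1` B)) `|`
        ~` \bigcup_n iota @` (K n `&` setT)); first exact: measurableU.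
    apply/seteqP; split=> [y /= By|y [[n _ [x [Kx Bx] <-]]|nKy]] /=.
    - have [[n _ [x [Kx _] xy]]|nKy] := pselect ((\bigcup_n iota @` (K n `&`
        setT)) y).
        left; exists n => //; exists x => //; split=> //=.
        by rewrite -f'S ?xy//; exists n.
      by right.
    - by rewrite f'S//; exists n.
    - by rewrite f'0// => -[x [n _ Kx] xy]; case: nKy; exists n => //; exists x.
  rewrite (_ : _ @^-1` _ = \bigcup_n iota @` (K n `&` (f @^-1` B)))//.
  apply/seteqP; split=> [y /=|y [n _ [x [Kx Bx] <-]]] /=.
    have [[x [n _ Kx] <-]|nS] := pselect (exists2 x, S x & iota x = y);
      last first.
      by rewrite f'0.
    by rewrite f'S => [Bx|]; exists n => //; exists x.
  by rewrite f'S//; exists n.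
have f'f : f' \o iota = f %[ae m].
  exists (~` S); split=> //; first exact: measurableC.
  by move=> x /= nfx Sx; apply: nfx => _; exact: f'S.
exists f' => //; apply: LfunE => //; rewrite -(Lnorm_pullback emb)//.
rewrite (ae_eq_Lnorm p1 (measurable_pullback emb mf') mf f'f).
by rewrite nrmE// ltry.
Qed.

Lemma CE_ae (f g : X -> R) : f \in L -> g \in L -> f = g %[ae m] ->
  CE p f = CE p g.
Proof.
move=> fL gL fg; rewrite /CE; congr ereal_inf; congr image.
have dist_eq u : Lip_b d u -> nrm m p (u \- f) = nrm m p (u \- g).
  move=> bu; have uL := Lip_b_Lfun p1 bu.
  apply: (ae_eq_nrm p1 (LfunB p1 uL fL) (LfunB p1 uL gL)).
  by apply: ae_mono fg => x /(_ I) /= ->.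
apply/seteqP; split=> u [bu uf]; split=> //; apply/(cvg_LpP p1 bu) => //.
  by move/(cvg_LpP p1 bu fL): uf; under eq_fun do rewrite dist_eq//.
by move/(cvg_LpP p1 bu gL): uf; under eq_fun do rewrite -dist_eq//.
Qed.

Lemma strong_gradient_ae_fun (f g G : X -> R) : f \in L -> g \in L ->
  f = g %[ae m] -> strong_gradient p f G -> strong_gradient p g G.
Proof.
move=> fL gL fg [GL fG]; split=> // e e0;
  have [u [h [bu hL uh uf hG]]] := fG e e0.
exists u, h; split=> //; rewrite (_ : nrm _ _ _ = nrm m p (u \- f))//.
have uL := Lip_b_Lfun p1 bu.
apply: ae_eq_nrm; rewrite ?LfunB//.
by apply: ae_mono fg => x /(_ I) /= ->.
Qed.

End invariance.

Lemma H1p_pullback (R : realType) (p : R) (p1 : 1 < p) (X X' : emtmSpace R)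
    (iota : X -> X') (emb : measure_preserving_embedding iota) (f' : X' -> R) :
  f' \in Lfun (@emeas R X') p%:E ->
  (H1p p (pullback iota f') <-> H1p p f').
Proof.
move=> fL'; have fL := Lfun_pullback emb fL';
  have CEE := CE_pullback emb p1 fL'.
by rewrite /H1p /pullback /= CEE; split=> -[_ ?].
Qed.

Lemma H1p_isomorphism_pullback (R : realType) (p : R) (p1 : 1 < p)
    (X X' : emtmSpace R) (iota : X -> X') :
  measure_preserving_embedding iota -> is_H1p_isomorphism p (pullback iota).
Proof.
move=> emb; split.
- by move=> f' [fL' fE]; apply/(H1p_pullback p1 emb).
- by move=> f' g' _ _ fg; exact: (ae_pullback emb fg).
- by move=> a f' g' _ _; exact: aeW.
- move=> f' [fL' _]; rewrite /H1p_norm /pullback (CE_pullback emb p1 fL').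
  by rewrite (Lnorm_pullback emb p (Lfun_measurable fL')).
- move=> f' g' [fL' _] [gL' _] fg.
  have fgL' := LfunB p1 fL' gL';
    have [fL gL] := (Lfun_pullback emb fL', Lfun_pullback emb gL').
  apply: (nrm_dist_eq0 p1 fL' gL') => e e0; rewrite -(nrm_pullback emb fgL').
  apply: le_trans (ltW e0); rewrite le_eqVlt; apply/orP; left; apply/eqP.
  have zeroL : (cst 0 : borel X -> R) \in Lfun (@emeas R X) p%:E by
    exact: Lfun_cst.
  have -> : nrm (@emeas R X) p ((f' \- g') \o iota) = nrm (@emeas R X) p (cst
    0).
    apply: (ae_eq_nrm p1 (Lfun_pullback emb fgL') zeroL).
    by apply: ae_mono fg => x /(_ I) /= fgx _; apply/eqP; rewrite subr_eq0;
      exact/eqP.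
  by rewrite /nrm Lnorm0// eqe gt_eqF// (lt_trans ltr01).
- move=> f [fL fE]; have [f' fL' f'f] := Lfun_pullback_surjective emb p1 fL.
  exists f' => //; apply/(H1p_pullback p1 emb fL'); split.
    exact: Lfun_pullback.
  by rewrite (CE_ae p1 (Lfun_pullback emb fL') fL f'f).
Qed.

Theorem theorem12p3 (R : realType) (p : R) (p1 : 1 < p) (X X' : emtmSpace R)
    (iota : X -> X') (iota_emb : measure_preserving_embedding iota) :
  is_H1p_isomorphism p (pullback iota) /\
  forall (f : X -> R) (f' : X' -> R),
    f' \in Lfun (@emeas R X') p%:E -> f = pullback iota f' %[ae @emeas R X] ->
    H1p p f ->
    (Dstar p1 f : X -> R) = pullback iota (Dstar p1 f') %[ae @emeas R X].
Proof.
split; first exact: H1p_isomorphism_pullback.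
move=> f f' fL' ff' [fL fE].
have f'iL := Lfun_pullback iota_emb fL'.
have CEff' : CE p f = CE p f'.
  by rewrite (CE_ae p1 fL f'iL ff') (CE_pullback iota_emb p1 fL').
have fE' : (CE p f' < +oo)%E by rewrite -CEff'.
have Dmin : minimal_relaxed_gradient f (Dstar p1 f).
  by apply: xgetPex; exact: minimal_relaxed_gradient_exists.
have Dmin' : minimal_relaxed_gradient f' (Dstar p1 f').
  by apply: xgetPex; exact: minimal_relaxed_gradient_exists.
have [sD nD] := minimal_relaxed_gradientP fL fE Dmin.
have [sD' nD'] := minimal_relaxed_gradientP fL' fE' Dmin'.
apply: (strong_gradient_unique p1 fL sD).
- apply: (strong_gradient_ae_fun p1 f'iL fL);
    last exact: (strong_gradient_pullback iota_emb p1).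
  by apply: ae_mono ff' => x /(_ I) ->.
- by rewrite nD.
- by rewrite (nrm_pullback iota_emb sD'.1) nD' CEff'.
Qed.
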